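(* Let $g\in\mathbb Q^*$ with $g\neq -1$ and $g$ not the square of a rational number. Let $h$ be the largest positive integer such that $g$ is an $h$-th power of a rational number. Write uniquely $g=g_1g_2^2$ with $g_1$ a squarefree integer and $g_2\in\mathbb Q$. Let $f\ge1$ and $1\le a\le f$ be integers with $(a,f)=1$. Let $\tilde g_1$ and $\tilde a$ be the odd parts of $g_1$ and $a$, and let $\beta=g_1/(g_1,f)$. If $g_1\equiv1\pmod 4$, or $g_1\equiv 2\pmod 4$ and $8\mid f$, or $g_1\equiv3\pmod4$ and $4\mid f$, then $$\delta(a,f,g)=\frac{A(a,f,h)}{\varphi(f)}\left(1-\left(\frac{a}{(f,g_1)}\right)\frac{(-1)^{\frac{\tilde g_1-1}{2}\cdot\frac{\tilde a-1}{2}}\mu(|\beta|)}{\prod_{p\mid\beta,\ p\mid h}(p-2)\prod_{p\mid \beta,\ p\nmid h}(p^2-p-1)}\right),$$ and otherwise $\delta(a,f,g)=A(a,f,h)/\varphi(f)$.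
   Context: $p$ always denotes a rational prime; $\zeta_m=e^{2\pi i/m}$; $\mu$ is the Möbius function and $\varphi$ Euler's totient; $(x,y)$ denotes the positive gcd. The odd part of a nonzero integer $m$ is $m/2^e$ where $2^e\mid m$, $2^{e+1}\nmid m$. For $(a,f)=1$, $\sigma_a$ is the automorphism of $\mathbb Q(\zeta_f)$ with $\sigma_a(\zeta_f)=\zeta_f^a$. For $n\ge1$, $g^{1/n}$ denotes an $n$-th root of $g$. Define $c_a(n)=1$ if the restriction of $\sigma_a$ to $\mathbb Q(\zeta_f)\cap\mathbb Q(\zeta_n,g^{1/n})$ is the identity and $c_a(n)=0$ otherwise, and $$\delta(a,f,g)=\sum_{n=1}^\infty\frac{\mu(n)c_a(n)}{[\mathbb Q(\zeta_f,\zeta_n,g^{1/n}):\mathbb Q]}.$$ Define $A(a,f,h)=\prod_{p\mid (a-1,f)}(1-\frac1p)\prod_{p\nmid f,\ p\mid h}(1-\frac1{p-1})\prod_{p\nmid f,\ p\nmid h}\left(1-\frac1{p(p-1)}\right)$ if $(a-1,f,h)=1$, and $A(a,f,h)=0$ otherwise. $(a/(f,g_1))$ denotes the Jacobi symbol, with the stipulation that $(a/2)=(-1)^{(a^2-1)/8}$. *)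

(* Defs.v *)
From HB Require Import structures.
From mathcomp Require Import all_boot all_order all_algebra all_field.
From mathcomp Require Import all_classical all_reals all_analysis.
Set Implicit Arguments.
Unset Strict Implicit.
Unset Printing Implicit Defensive.
Import Order.TTheory GRing.Theory Num.Theory.
Import numFieldNormedType.Exports.
Local Open Scope ring_scope.

Definition squarefree (n : nat) : bool :=
  (0 < n)%N && all (fun p => ~~ (p ^ 2 %| n)%N) (primes n).

Definition moebius (n : nat) : int :=
  if squarefree n then (-1) ^+ size (primes n) else 0.

Definition odd_part (m : int) : int := (m %/ (2 ^ logn 2 `|m|)%N%:Z)%Z.

(* Extended to p = 2 by (a/2) = (-1)^((a^2-1)/8), a odd. *)
Definition legendre (a p : nat) : int :=
  if (p %| a)%N then 0
  else if (p == 2)%N then (-1) ^+ ((a ^ 2 - 1) %/ 8)%N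
  else if [exists x : 'I_p, x ^ 2 == a %[mod p]]%N then 1 else -1.

(* b may be even: the factor 2 contributes legendre a 2. *)
Definition jacobi (a b : nat) : int :=
  \prod_(p <- primes b) legendre a p ^+ logn p b.

(* n.-root x is the n-th root of x of least argument in [0, 2 pi), so that
   n.-root (-1) = e^(i pi / n). *)
Definition zeta (n : nat) : algC := (n.-root (-1)) ^+ 2.

(* The number field Q(s), for s a finite list of algebraic numbers, together
   with its embedding in algC: adj_inj s maps a list of generators of adj s
   onto s. *)
Definition adj (s : seq algC) : fieldExtType rat := tag (num_field_exists s).

Definition adj_inj (s : seq algC) : {rmorphism adj s -> algC} :=
  tag (tagged (num_field_exists s)).

Definition adj_gens (s : seq algC) : seq (adj s) :=
  s2val (tagged (tagged (num_field_exists s))).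

Lemma adj_gensE s : map (adj_inj s) (adj_gens s) = s.
Proof. exact: (s2valP (tagged (tagged (num_field_exists s)))). Qed.

Lemma adj_gens_full s : <<1 & adj_gens s>>%VS = fullv.
Proof. exact: (s2valP' (tagged (tagged (num_field_exists s)))). Qed.

Definition adj_deg (s : seq algC) : nat := \dim {:adj s}.

Definition cyclo (f : nat) : fieldExtType rat := adj [:: zeta f].

Definition cyclo_gen (f : nat) : cyclo f := head 0 (adj_gens [:: zeta f]).

Lemma adj_gens_cyclo f : adj_gens [:: zeta f] = [:: cyclo_gen f].
Proof.
rewrite /cyclo_gen; have := adj_gensE [:: zeta f].
by case: (adj_gens _) => [//|x [|//]].
Qed.

Lemma cyclo_genE f : adj_inj _ (cyclo_gen f) = zeta f.
Proof. by have := adj_gensE [:: zeta f]; rewrite adj_gens_cyclo => -[]. Qed.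

Lemma zeta_exp f : zeta f ^+ f = 1.
Proof.
case: f => [|f]; first by rewrite expr0.
by rewrite /zeta exprAC rootCK // sqrrN expr1n.
Qed.

Lemma cyclo_horner f (x : cyclo f) :
  exists p : {poly rat}, adj_inj _ x = (map_poly ratr p).[zeta f].
Proof.
have : x \in <<1; cyclo_gen f>>%VS.
  by have := adj_gens_full [:: zeta f]; rewrite adj_gens_cyclo adjoin_seq1 => ->;
    rewrite memvf.
move/Fadjoin_polyP => [q /polyOver1P [p ->] ->]; exists p.
rewrite -horner_map cyclo_genE -map_poly_comp; congr (_.[_]).
by apply: eq_map_poly => c /=; rewrite alg_num_field fmorph_rat.
Qed.

Lemma sigma_exists (a f : nat) : coprime a f ->
  {s : {rmorphism cyclo f -> cyclo f} | s (cyclo_gen f) = cyclo_gen f ^+ a}.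
Proof.
move=> /Qn_aut_exists[u uE].
have uz : u (zeta f) = zeta f ^+ a by apply/uE/zeta_exp.
have uP (x : cyclo f) : exists y : cyclo f, u (adj_inj _ x) = adj_inj _ y.
  have [p ->] := cyclo_horner x.
  exists (map_poly (in_alg (cyclo f)) p).[cyclo_gen f ^+ a].
  rewrite -!horner_map uz rmorphXn cyclo_genE -!map_poly_comp.
  congr (_.[_]); apply: eq_map_poly => c /=.
  by rewrite fmorph_rat alg_num_field fmorph_rat.
have [s sE] := restrict_aut_to_num_field uP.
by exists s; apply: (fmorph_inj (adj_inj _)); rewrite sE rmorphXn /= cyclo_genE uz.
Qed.

Lemma sigma_unique (f : nat) (s t : {rmorphism cyclo f -> cyclo f}) :
  s (cyclo_gen f) = t (cyclo_gen f) -> s =1 t.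
Proof.
move=> st x.
have : x \in <<1; cyclo_gen f>>%VS.
  by have := adj_gens_full [:: zeta f]; rewrite adj_gens_cyclo adjoin_seq1 => ->;
    rewrite memvf.
move/Fadjoin_polyP => [q /polyOver1P [p ->] ->].
rewrite -!horner_map -!map_poly_comp st; congr (_.[_]).
by apply: eq_map_poly => c /=; rewrite !alg_num_field !fmorph_rat.
Qed.

(* For a prime to f, the automorphism of Q(zeta_f) mapping zeta_f to
   zeta_f^a (any ring endomorphism of a number field is an automorphism). *)
Definition sigma (a f : nat) (af : coprime a f) :
  {rmorphism cyclo f -> cyclo f} := sval (sigma_exists af).

Definition kummer_gens (n : nat) (g : rat) : seq algC :=
  [:: zeta n; n.-root (ratr g)].

(* The intersection of Q(zeta_f) and Q(zeta_n, g^(1/n)) is taken inside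
   algC. *)
Definition c_a (a f : nat) (af : coprime a f) (g : rat) (n : nat) : bool :=
  `[< forall x : cyclo f,
        (exists y : adj (kummer_gens n g), adj_inj _ y = adj_inj _ x) ->
        sigma af x = x >].

Section Density.
Variable R : realType.

Definition delta_term (a f : nat) (af : coprime a f) (g : rat) (n : nat) : R :=
  (moebius n)%:~R * (c_a af g n)%:R / (adj_deg (zeta f :: kummer_gens n g))%:R.

Definition delta (a f : nat) (af : coprime a f) (g : rat) : R :=
  limn (fun N => \sum_(1 <= n < N) delta_term af g n).

Definition A_tail (f h N : nat) : R :=
  \prod_(0 <= p < N | [&& prime p, ~~ (p %| f)%N & ~~ (p %| h)%N])
    (1 - (p%:R * (p%:R - 1))^-1).

Lemma A_tail_cvg (f h : nat) : cvgn (A_tail f h).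
Proof.
have F01 p : prime p -> 0 <= (1 - (p%:R * (p%:R - 1))^-1 : R) <= 1.
  move=> pp; have p2 : 2 <= p%:R :> R by rewrite ler_nat prime_gt1.
  have q1 : 1 <= p%:R * (p%:R - 1) :> R.
    rewrite -[1]mulr1 ler_pM ?ler01 ?mulr1 //; first by rewrite (le_trans _ p2) ?ler1n.
    by rewrite lerBrDr.
  have q0 : 0 < p%:R * (p%:R - 1) :> R by apply: lt_le_trans q1.
  apply/andP; split; last by rewrite gerBl invr_ge0 ltW.
  by rewrite subr_ge0 invf_le1.
have A0 N : 0 <= A_tail f h N.
  by apply: prodr_ge0 => p /and3P[/F01/andP[]].
apply: nonincreasing_is_cvgn; last by exists 0 => _ [N _ <-].
apply/nonincreasing_seqP => N; rewrite {1}/A_tail big_mkcond big_nat_recr //=.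
rewrite -big_mkcond -/(A_tail f h N); case: ifP => [/and3P[/F01/andP[_ le1]] _ _|_].
  by rewrite ler_piMr.
by rewrite mulr1.
Qed.

Definition A_const (a f h : nat) : R :=
  if gcdn (gcdn (a - 1) f) h == 1%N then
    \prod_(p <- primes (gcdn (a - 1) f)) (1 - p%:R^-1) *
    \prod_(p <- primes h | ~~ (p %| f)%N) (1 - (p%:R - 1)^-1) *
    limn (A_tail f h)
  else 0.

End Density.

(* Main.v *)
Require Import Defs.
From HB Require Import structures.
From mathcomp Require Import all_boot all_order all_algebra all_field.
From mathcomp Require Import cyclic.
From mathcomp Require Import all_classical all_reals all_analysis.
From mathcomp Require Import ring lra zify.
Set Implicit Arguments.
Unset Strict Implicit.
Unset Printing Implicit Defensive.
Import Order.TTheory GRing.Theory Num.Theory.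
Import numFieldNormedType.Exports.
Local Open Scope ring_scope.

(* For squarefree n put N = lcm(f, n) and r = g^(1/n). The degree of r over
   Q(zeta_N) is the product of the primes p | n with r^(n/p) not in Q(zeta_N).
   For odd p this happens exactly when p does not divide h, because a real p-th
   root of g lying in a cyclotomic field has only real conjugates, hence is
   rational; for p = 2 it happens unless the discriminant of Q(sqrt g1) divides
   N. That criterion and the action of sigma_u on sqrt g1 come from writing
   sqrt g1 as a product of sqrt(+-p), i and sqrt 2 in cyclotomic fields, on which
   sigma_u acts by Legendre symbols. Consequently the n-th term of the series is
   w(n) (1 + kappa [2 beta | n]) / phi(f), the second summand being present only
   in the exceptional congruence cases, where w is multiplicative on squarefree
   numbers and kappa is the sign by which sigma_a acts on a square root of
   +-(f, g1). Both series are absolutely convergent and sum to Euler products. *)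

(** * Primitivity of zeta *)

(** Squarefreeness of n makes the problem local: 4 and 8 can divide N only through f, so for even n
    the discriminant of Q(sqrt g1) divides N exactly when the congruence condition holds at f and 2
    beta | n. In that case the degree is halved, while c_a acquires the extra condition kappa = 1;
    the identity 2 [kappa = 1] = 1 + kappa, valid for a sign, gives the bracket of the n-th term.
    The maximality of h enters by way of: if g is a p-th power, then p | h. Since g is not a square,
    h is odd, so the prime 2 is never counted twice. Restricting the sum of w to the multiples of 2
    beta replaces 1 + x_p by x_p at the primes p | 2 beta, where x_p = w(p). As x_2 = -1/2, the
    ratio x_2 / (1 + x_2) is -1, which is the minus sign of the formula; p | beta contributes -1/(p
    - 2) or -1/(p^2 - p - 1) according as p | h or not. One obstacle precedes all this: [zeta n]
    comes from [n.-root (-1)], which is singled out by the size of its real part, so its primitivity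
    needs a geometric argument. *)

(** Put x + iy = e^(i theta) and c + is = e^(i alpha). The inequalities on x c + y s and x c - y s
    say that rotation by alpha or -alpha does not bring the point nearer to 1, so theta is at most
    alpha/2 in absolute value; this is 1 + c <= 2 x^2, with x >= 0. But x <= c says that theta is at
    least alpha, which leaves only theta = 0. *)
Lemma unit_circle_gap (x y c s : algC) :
    x \is Num.real -> y \is Num.real -> c \is Num.real -> s \is Num.real ->
    x ^+ 2 + y ^+ 2 = 1 -> c ^+ 2 + s ^+ 2 = 1 -> c != 1 ->
    x * c + y * s <= x -> x * c - y * s <= x ->
  x <= c -> x = 1.
Proof.
move=> Rx Ry Rc Rs xy1 cs1 c_neq1 le1 le2 le_xc.
have le1P (a b : algC) : a \is Num.real -> b \is Num.real ->
    a ^+ 2 + b ^+ 2 = 1 -> a <= 1.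
  move=> Ra Rb ab; apply: le_trans (real_ler_norm Ra) _.
  rewrite -(@expr_le1 _ 2) // real_normK // -ab lerDl real_exprn_even_ge0 //.
have c_lt1 : 0 < 1 - c by rewrite subr_gt0 lt_neqAle c_neq1 (le1P _ _ Rc Rs).
have x_ge0 : 0 <= x.
  rewrite -(pmulr_lge0 _ c_lt1) -(@pmulr_lge0 _ 2) //.
  have -> : x * (1 - c) * 2 = (x - (x * c + y * s)) + (x - (x * c - y * s)) by ring.
  by rewrite addr_ge0 // subr_ge0.
have sq_le : (1 - x ^+ 2) * (1 + c) <= x ^+ 2 * (1 - c).
  rewrite -(ler_pM2l c_lt1).
  have -> : (1 - c) * ((1 - x ^+ 2) * (1 + c)) = (y * s) ^+ 2.
    rewrite exprMn.
    have -> : y ^+ 2 = 1 - x ^+ 2 by rewrite -xy1; ring.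
    have -> : s ^+ 2 = 1 - c ^+ 2 by rewrite -cs1; ring.
    ring.
  have -> : (1 - c) * (x ^+ 2 * (1 - c)) = (x * (1 - c)) ^+ 2 by ring.
  rewrite -[_ ^+ 2](@real_normK _ (y * s)) ?realM //.
  rewrite ler_pXn2r ?nnegrE // ?(mulr_ge0, ltW c_lt1) //.
  rewrite real_ler_norml ?realM //.
  apply/andP; split; rewrite -subr_ge0.
    have -> : y * s - - (x * (1 - c)) = x - (x * c - y * s) by ring.
    by rewrite subr_ge0.
  have -> : x * (1 - c) - (y * s) = x - (x * c + y * s) by ring.
  by rewrite subr_ge0.
have x_le1 := le1P _ _ Rx Ry xy1.
apply/eqP; rewrite eq_le x_le1 /=.
have h2 : 1 + c <= 2 * x ^+ 2.
  rewrite -subr_ge0.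
  have -> : 2 * x ^+ 2 - (1 + c) = x ^+ 2 * (1 - c) - (1 - x ^+ 2) * (1 + c) by ring.
  by rewrite subr_ge0.
have h3 : 2 * x ^+ 2 <= 2 * x.
  by rewrite ler_pM2l // expr2 ler_piMl.
have : 1 + x <= 2 * x by apply: le_trans h3; apply: le_trans h2; rewrite lerD2l.
by rewrite mulr_natl mulr2n lerD2r.
Qed.

Lemma seq_real_max (T : eqType) (F : T -> algC) (s : seq T) :
  (forall x, F x \is Num.real) -> s != [::] ->
  exists2 x, x \in s & forall y, y \in s -> F y <= F x.
Proof.
move=> RF; elim: s => // x [|y s] IHs _.
  by exists x; rewrite ?mem_head // => y; rewrite inE => /eqP->.
have [//|m m_s m_max] := IHs; have [le_xm | lt_mx] := real_leP (RF x) (RF m).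
  exists m => [|t]; first by rewrite inE m_s orbT.
  by rewrite inE => /predU1P[->|/m_max].
exists x => [|t]; first by rewrite mem_head.
by rewrite inE => /predU1P[->|/m_max /le_trans->] //; apply: ltW.
Qed.

Lemma unity_normC N (v : algC) : (0 < N)%N -> v ^+ N = 1 -> `|v| = 1.
Proof.
move=> N_gt0 vN; apply/eqP; rewrite -(@pexpr_eq1 _ _ N) // ?normr_ge0 //.
by rewrite -normrX vN normr1.
Qed.

Lemma normC1_Re1 (v : algC) : `|v| = 1 -> 'Re v = 1 -> v = 1.
Proof.
move=> v1 Re_v; have /eqP := normC2_Re_Im v.
rewrite v1 Re_v expr1n -subr_eq0 opprD addrA subrr sub0r oppr_eq0.
by rewrite expf_eq0 /= => /eqP Im_v; rewrite [v]algCrect Re_v Im_v mulr0 addr0.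
Qed.

(* Among the translates [v w^j], let [v'] have the largest real part; then
   [v' = 1] by [unit_circle_gap], so that [v] is a power of [w]. *)
Lemma max_Re_primitive_root N (w : algC) :
    (0 < N)%N -> w ^+ N = 1 -> w != 1 ->
    (forall v, v ^+ N = 1 -> v != 1 -> 'Re v <= 'Re w) ->
  N.-primitive_root w.
Proof.
move=> N_gt0 wN w_neq1 w_max.
have circle (v : algC) : `|v| = 1 -> 'Re v ^+ 2 + 'Im v ^+ 2 = 1.
  by move=> v1; rewrite -normC2_Re_Im v1 expr1n.
have w1 := unity_normC N_gt0 wN.
have [z zP] := C_prim_root_exists N_gt0.
have zN := prim_expr_order zP.
pose s := [seq z * w ^+ j | j <- iota 0 N].
have s_mul j : z * w ^+ j \in s.
  apply/mapP; exists (j %% N)%N; first by rewrite mem_iota ltn_mod.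
  by rewrite expr_mod.
have [v v_s v_max] : exists2 v, v \in s & forall y, y \in s -> 'Re y <= 'Re v.
  apply: seq_real_max => [x|]; first exact: Creal_Re.
  by rewrite -size_eq0 size_map size_iota -lt0n.
have [j _ vE] := mapP v_s.
have vN : v ^+ N = 1 by rewrite vE exprMn zN exprAC wN expr1n mulr1.
have v1 : `|v| = 1 := unity_normC N_gt0 vN.
have wV : w^-1 = w^* by rewrite invC_norm w1 expr1n invr1 mul1r.
have w0 : w != 0 by rewrite -normr_eq0 w1 oner_eq0.
have wVX : w^-1 = w ^+ N.-1.
  by apply: (mulIf w0); rewrite mulVf // -exprSr prednK.
suff v_eq1 : v = 1.
  have [m mP _] := prim_order_exists N_gt0 wN.
  have : z ^+ m = 1.
    have -> : z = (w^-1) ^+ j by rewrite exprVn -[RHS]mul1r -v_eq1 vE mulfK // expf_neq0.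
    by rewrite exprAC exprVn (prim_expr_order mP) invr1 expr1n.
  move/eqP; rewrite -(prim_order_dvd zP) => N_m.
  have m_N : (m %| N)%N by rewrite (prim_order_dvd mP) wN.
  by have -> : N = m by apply/eqP; rewrite eqn_dvd N_m.
(* For [v] different from 1, [w_max] gives Re v <= Re w, and both v w and v / w = v w^(N-1) compete
   with [v] in the list [s]. *)
apply/eqP; case: eqP => // /eqP v_neq1.
have Re1 : 'Re v = 1.
  apply: (@unit_circle_gap _ ('Im v) ('Re w) ('Im w)); rewrite ?Creal_Re ?Creal_Im ?circle //.
  - by apply: contraNneq w_neq1 => /(normC1_Re1 w1) ->.
  - have -> : 'Re v * 'Re w + 'Im v * 'Im w = 'Re (v * w^*).
      by rewrite ReM Re_conj Im_conj mulrN opprK.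
    apply: v_max; rewrite -wV vE -mulrA; rewrite wVX -exprD.
    exact: s_mul.
  - by rewrite -ReM; apply: v_max; rewrite vE -mulrA -exprSr; apply: s_mul.
  - exact: w_max.
by move: v_neq1; rewrite (normC1_Re1 v1 Re1) eqxx.
Qed.

(** The root [n.-root (-1)] maximises the real part only among the n-th roots of -1 in the closed
    upper half-plane. A nontrivial 2n-th root of unity of largest real part is primitive, hence
    itself an n-th root of -1; it or its conjugate lies in that half-plane, so the maximum is the
    same. *)
Lemma nroot_N1_prim n : (0 < n)%N -> (n * 2).-primitive_root (n.-root (-1) : algC).
Proof.
move=> n_gt0; have N_gt0 : (0 < n * 2)%N by rewrite muln_gt0 n_gt0.
set y := n.-root _; have yn : y ^+ n = -1 by rewrite rootCK.
have neq1N : -1 != 1 :> algC by rewrite -subr_eq0 -opprD oppr_eq0 (pnatr_eq0 _ 2).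
have y_neq1 : y != 1.
  by apply: contraNneq neq1N => y1; rewrite -yn y1 expr1n.
have [z zP] := C_prim_root_exists N_gt0.
pose s := [seq v <- [seq z ^+ i | i <- iota 0 (n * 2)] | v != 1].
have s_mem v : v ^+ (n * 2) = 1 -> v != 1 -> v \in s.
  move=> vN v1; rewrite mem_filter v1; have [i ->] := prim_rootP zP vN.
  by apply/mapP; exists (val i); rewrite ?mem_iota ?ltn_ord.
have [v v_s v_max] : exists2 v, v \in s & forall t, t \in s -> 'Re t <= 'Re v.
  apply: seq_real_max => [x|]; first exact: Creal_Re.
  apply/eqP => s0; have := s_mem (-1).
  by rewrite s0 exprM exprAC sqrrN !expr1n => /(_ erefl neq1N).
have [v_neq1 vN] : v != 1 /\ v ^+ (n * 2) = 1.
  move: v_s; rewrite mem_filter => /andP[-> /mapP[i _ ->]].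
  by rewrite exprAC (prim_expr_order zP) expr1n.
apply: max_Re_primitive_root => // [|t tN t_neq1].
  by rewrite exprM yn sqrrN expr1n.
apply: le_trans (v_max _ (s_mem _ tN t_neq1)) _.
have rootN1 (u : algC) : (n * 2).-primitive_root u -> u ^+ n = -1.
  move=> uP; have /eqP : (u ^+ n) ^+ 2 = 1 by rewrite -exprM prim_expr_order.
  rewrite sqrf_eq1 -(prim_order_dvd uP) => /orP[/(dvdn_leq n_gt0)|/eqP//].
  by rewrite muln2 -addnn -{3}[n]addn0 leq_add2l leqNgt n_gt0.
have max_v (u : algC) : u ^+ (n * 2) = 1 -> u != 1 -> 'Re u = 'Re v -> u ^+ n = -1.
  move=> uN u1 uv; apply: rootN1; apply: max_Re_primitive_root => // t' t'N t'1.
  by rewrite uv; apply: v_max; apply: s_mem.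
have [Im_ge|Im_lt] := real_leP (@real0 _) (Creal_Im v).
  by apply: rootC_Re_max Im_ge => //; apply: max_v.
rewrite -Re_conj; apply: rootC_Re_max => //.
  apply: max_v; rewrite ?Re_conj //; first by rewrite -rmorphXn vN rmorph1.
  by apply: contraNneq v_neq1 => /(congr1 Num.conj); rewrite conjCK rmorph1 => ->.
by rewrite Im_conj oppr_ge0 ltW.
Qed.

Lemma zeta_prim n : (0 < n)%N -> n.-primitive_root (zeta n).
Proof.
move=> n_gt0; have := exp_prim_root (nroot_N1_prim n_gt0) 2.
by rewrite -/(zeta n) gcdnMl mulnK.
Qed.

(** * Cyclotomic fields inside algC *)

Local Notation QtoC := (ratr : rat -> algC).
Local Notation pQtoC := (map_poly ratr).

(** Membership in Q(zeta_M) is a predicate on [algC], so that elements of different abstract number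
    fields can be compared through their embeddings. *)
Definition in_cyclotomic (M : nat) (x : algC) :=
  exists p : {poly rat}, x = (pQtoC p).[zeta M].

Section InCyclotomic.
Variable M : nat.
Implicit Types x y : algC.

Lemma in_cyclotomic_rat (c : rat) : in_cyclotomic M (ratr c).
Proof. by exists c%:P; rewrite map_polyC hornerC. Qed.

Lemma in_cyclotomicD x y :
  in_cyclotomic M x -> in_cyclotomic M y -> in_cyclotomic M (x + y).
Proof. by move=> [p ->] [q ->]; exists (p + q); rewrite rmorphD hornerD. Qed.

Lemma in_cyclotomicM x y :
  in_cyclotomic M x -> in_cyclotomic M y -> in_cyclotomic M (x * y).
Proof. by move=> [p ->] [q ->]; exists (p * q); rewrite rmorphM hornerM. Qed.

Lemma in_cyclotomicX x k : in_cyclotomic M x -> in_cyclotomic M (x ^+ k).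
Proof. by move=> [p ->]; exists (p ^+ k); rewrite rmorphXn horner_exp. Qed.

Lemma in_cyclotomicB x y :
  in_cyclotomic M x -> in_cyclotomic M y -> in_cyclotomic M (x - y).
Proof. by move=> [p ->] [q ->]; exists (p - q); rewrite rmorphB hornerD hornerN. Qed.

Lemma in_cyclotomic1 : in_cyclotomic M 1.
Proof. by rewrite -(rmorph1 QtoC); apply: in_cyclotomic_rat. Qed.

Lemma in_cyclotomic_prod (I : Type) (r : seq I) (P : pred I) (F : I -> algC) :
  (forall i, P i -> in_cyclotomic M (F i)) ->
  in_cyclotomic M (\prod_(i <- r | P i) F i).
Proof. by move=> FM; apply: (big_ind (in_cyclotomic M)) => //; [apply: in_cyclotomic1 | apply: in_cyclotomicM]. Qed.

Hypothesis M_gt0 : (0 < M)%N.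

Lemma in_cyclotomic_root w : w ^+ M = 1 -> in_cyclotomic M w.
Proof.
move=> /(prim_rootP (zeta_prim M_gt0))[i ->].
by exists 'X^i; rewrite map_polyXn hornerXn.
Qed.

Lemma in_cyclotomicS M' x : (M' %| M)%N -> in_cyclotomic M' x -> in_cyclotomic M x.
Proof.
move=> dvdM [p ->].
have [i zE] : {i : 'I_M | zeta M' = zeta M ^+ i}.
  by apply: prim_rootP (zeta_prim M_gt0) _ _; rewrite -(divnK dvdM) mulnC exprM zeta_exp expr1n.
exists (p \Po 'X^i).
by rewrite map_comp_poly map_polyXn horner_comp hornerXn zE.
Qed.

(* Stands for sigma_u: an automorphism of algC, constrained on the [M]-th roots
   of unity only. *)
Definition acts_as (tau : {rmorphism algC -> algC}) (u : nat) :=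
  forall w, w ^+ M = 1 -> tau w = w ^+ u.

Lemma acts_as_horner tau u (p : {poly rat}) w : acts_as tau u -> w ^+ M = 1 ->
  tau (pQtoC p).[w] = (pQtoC p).[w ^+ u].
Proof.
move=> tauP wM; rewrite -horner_map tauP // -map_poly_comp.
by congr (_.[_]); apply: eq_map_poly => c /=; rewrite fmorph_rat.
Qed.

Lemma acts_as_comm tau tau' u v x : acts_as tau u -> acts_as tau' v ->
  in_cyclotomic M x -> tau (tau' x) = tau' (tau x).
Proof.
have zM k : (zeta M ^+ k) ^+ M = 1 by rewrite exprAC zeta_exp expr1n.
move=> tauP tauP' [p ->].
by rewrite !(acts_as_horner p tauP', acts_as_horner p tauP) ?zeta_exp // exprAC.
Qed.

Lemma acts_as_id tau x : acts_as tau 1 -> in_cyclotomic M x -> tau x = x.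
Proof. by move=> tauP [p ->]; rewrite (acts_as_horner _ tauP) ?zeta_exp // expr1. Qed.

(* The reduction of [x] modulo the [M]-th cyclotomic polynomial is a
   polynomial of degree less than [totient M] taking the value [x] at all
   primitive [M]-th roots of unity, hence it is constant. *)
Lemma in_cyclotomic_Crat x : in_cyclotomic M x ->
    (forall tau u, coprime u M -> acts_as tau u -> tau x = x) ->
  x \in Crat.
Proof.
have zP := zeta_prim M_gt0.
move=> [p ->] fixP; have [q [Dq q_mon] q_root] := minCpolyP (zeta M).
pose r := p %% q.
have size_q : size q = (totient M).+1.
  by rewrite -(size_map_poly QtoC) -Dq (minCpoly_cyclotomic zP) size_cyclotomic.
have pr w : root (minCpoly (zeta M)) w -> (pQtoC p).[w] = (pQtoC r).[w].
  rewrite Dq => qw; rewrite {1}(divp_eq p q) rmorphD rmorphM hornerD hornerM /=.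
  by rewrite (rootP qw) mulr0 add0r.
set c := (pQtoC p).[zeta M]; pose d := pQtoC r - c%:P.
have r_small : (size r <= totient M)%N.
  by rewrite -ltnS -size_q ltn_modp monic_neq0.
suff d0 : d = 0.
  have := congr1 (fun s : {poly algC} => s`_0) d0.
  rewrite /= coefB coefC coef_map coef0 /= => /eqP; rewrite subr_eq0 => /eqP <-.
  exact: Crat_rat.
apply/eqP; apply: contraT => d_neq0.
pose rs := [seq zeta M ^+ (val k) | k <- enum 'I_M & coprime (val k) M].
have size_rs : size rs = totient M.
  rewrite size_map totient_count_coprime size_filter -sum1_count big_enum_cond big_mkord.
  by rewrite big_mkcond; apply: eq_bigr => i _; rewrite /= coprime_sym; case: coprime.
have := @max_poly_roots _ d rs d_neq0.
have -> : all (root d) rs.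
  apply/allP => _ /mapP[k k_in ->]; move: k_in; rewrite mem_filter => /andP[co_k _].
  have [tau tauP] := Qn_aut_exists co_k.
  rewrite /root /d hornerD hornerN hornerC -pr; last first.
    by rewrite (minCpoly_cyclotomic zP) root_cyclotomic // prim_root_exp_coprime.
  by rewrite -(acts_as_horner p tauP) ?zeta_exp // (fixP tau (val k)) // subrr.
have -> : uniq rs.
  rewrite map_inj_in_uniq ?filter_uniq -?enumT ?enum_uniq // => i j _ _ /eqP.
  by rewrite (eq_prim_root_expr zP) !modn_small ?ltn_ord // => /eqP/val_inj.
move=> /(_ isT isT); rewrite size_rs ltnNge.
suff -> : (size d <= totient M)%N by [].
apply: leq_trans (size_polyD _ _) _.
rewrite geq_max size_map_poly r_small size_polyN (leq_trans (size_polyC_leq1 _)) //.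
by rewrite totient_gt0.
Qed.

End InCyclotomic.

(** * Square roots of integers in cyclotomic fields *)

Lemma squarefree_gt0 n : squarefree n -> (0 < n)%N.
Proof. by case/andP. Qed.

Lemma squarefree_logn n p : squarefree n -> p \in primes n -> logn p n = 1%N.
Proof.
move=> /andP[n_gt0 /allP sq] p_n; have := sq _ p_n.
have pp : prime p by move: p_n; rewrite mem_primes => /and3P[].
rewrite pfactor_dvdn // -ltnNge; have : (0 < logn p n)%N by rewrite logn_gt0.
by case: (logn p n) => [|[]].
Qed.

Lemma squarefree_prod n : squarefree n -> (\prod_(p <- primes n) p)%N = n.
Proof.
move=> sq; rewrite [RHS]prod_prime_decomp ?squarefree_gt0 // prime_decompE big_map.
rewrite big_seq [RHS]big_seq; apply: eq_bigr => p p_n.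
by rewrite squarefree_logn.
Qed.

Lemma squarefree_totient n : squarefree n ->
  totient n = (\prod_(p <- primes n) p.-1)%N.
Proof.
move=> sq; rewrite totientE ?squarefree_gt0 //.
rewrite big_seq [RHS]big_seq; apply: eq_bigr => p p_n.
by rewrite squarefree_logn // muln1.
Qed.

Lemma squarefree_dvd m n : squarefree n -> (m %| n)%N -> squarefree m.
Proof.
move=> /andP[n_gt0 /allP sq] m_n; have m_gt0 := dvdn_gt0 n_gt0 m_n.
rewrite /squarefree m_gt0; apply/allP => p; rewrite mem_primes => /and3P[pp _ p_m].
by apply: contra (sq p _) => [/dvdn_trans->//|]; rewrite mem_primes pp n_gt0 (dvdn_trans p_m).
Qed.

Lemma squarefree_dvdP m n : squarefree m ->
  reflect (forall p, prime p -> (p %| m)%N -> (p %| n)%N) (m %| n)%N.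
Proof.
move=> sq; apply: (iffP idP) => [m_n p _ p_m | H]; first exact: dvdn_trans m_n.
have m_gt0 := squarefree_gt0 sq.
have [->|n_gt0] := posnP n; first exact: dvdn0.
apply/dvdn_partP => // p; rewrite mem_primes => /and3P[pp _ p_m].
rewrite p_part squarefree_logn ?mem_primes ?pp ?m_gt0 // expn1; exact: H.
Qed.

(** The p - 1 nonzero residues are all roots of X^(p-1) - 1 in the field F_p, and so many roots
    include a primitive one. *)
Lemma primitive_root_mod p : prime p ->
  exists w : nat, coprime w p /\ forall u, coprime u p -> exists i, (u = w ^ i %[mod p])%N.
Proof.
move=> pp; pose rs := [seq x <- enum 'F_p | x != 0].
have x_unity (x : 'F_p) : x != 0 -> x ^+ p.-1 = 1.
  move=> x0; apply: (mulfI x0); rewrite -exprS prednK ?prime_gt0 // mulr1.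
  by rewrite -[RHS]expf_card card_Fp.
have size_rs : (p.-1 <= size rs)%N.
  have -> : rs = seq.filter (predC (pred1 (0 : 'F_p))) (enum 'F_p) by [].
  rewrite size_filter -(leq_add2l (count (pred1 (0 : 'F_p)) (enum 'F_p))) count_predC -cardE card_Fp //.
  by rewrite (@eq_count _ _ (pred1 0)) // count_uniq_mem ?enum_uniq // mem_enum inE add1n prednK ?prime_gt0.
have /hasP[z] : has (p.-1).-primitive_root rs.
  apply: has_prim_root size_rs; rewrite ?filter_uniq -?enumT ?enum_uniq //.
    by rewrite -ltnS prednK ?prime_gt0 ?prime_gt1.
  by apply/allP => x; rewrite mem_filter => /andP[/x_unity x1 _]; apply/unity_rootP.
rewrite mem_filter => /andP[z0 _] zP.
have nat_neq0 u : (u%:R == 0 :> 'F_p) = (p %| u)%N.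
  by rewrite -(dvdn_pcharf (pchar_Fp pp)).
exists (val z); have zE : (val z)%:R = z by rewrite natr_Zp.
split=> [|u]; first by rewrite coprime_sym prime_coprime // -nat_neq0 zE.
rewrite coprime_sym prime_coprime // -nat_neq0 => /x_unity /(prim_rootP zP)[i uE].
exists i; have := congr1 (@nat_of_ord _) uE; by rewrite -zE -natrX !val_Fp_nat // zE.
Qed.

(** Keeps a square root together with the quadratic character by which the sigma_u act on it, so
    that both can be multiplied factor by factor. The character does not depend on the sign chosen
    for [S]. *)
Definition sqchar (M : nat) (x : int) (c : nat -> int) :=
  exists S : algC, [/\ S ^+ 2 = x%:~R, in_cyclotomic M S &
    forall tau u, coprime u M -> acts_as M tau u -> tau S = (c u)%:~R * S].

Lemma sqchar1 M : sqchar M 1 (fun=> 1).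
Proof.
by exists 1; split; rewrite ?expr1n //; [apply: in_cyclotomic1|move=> *; rewrite rmorph1 mulr1].
Qed.

Lemma sqcharM M x y c d : sqchar M x c -> sqchar M y d ->
  sqchar M (x * y) (fun u => c u * d u).
Proof.
move=> [S [S2 MS tS]] [T [T2 MT tT]]; exists (S * T); split.
- by rewrite exprMn S2 T2 intrM.
- exact: in_cyclotomicM.
by move=> tau u co ac; rewrite rmorphM /= (tS _ _ co ac) (tT _ _ co ac) intrM mulrACA.
Qed.

Lemma acts_asS M M' tau u : (M' %| M)%N -> acts_as M tau u -> acts_as M' tau u.
Proof. by move=> dvdM ac w wM; apply: ac; rewrite -(divnK dvdM) mulnC exprM wM expr1n. Qed.

Lemma sqcharS M M' x c : (0 < M)%N -> (M' %| M)%N -> sqchar M' x c -> sqchar M x c.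
Proof.
move=> M_gt0 dvdM [S [S2 MS tS]]; exists S; split => //; first exact: in_cyclotomicS MS.
by move=> tau u co ac; apply: tS; [apply: coprime_dvdr co | apply: acts_asS ac].
Qed.

Lemma sqchar_eq M x c d : (forall u, coprime u M -> c u = d u) -> sqchar M x c -> sqchar M x d.
Proof.
by move=> cd [S [S2 MS tS]]; exists S; split=> // tau u co ac; rewrite (tS _ _ co ac) cd.
Qed.

Lemma sqchar_prod M (r : seq nat) (P : pred nat) (x : nat -> int) (c : nat -> nat -> int) :
  (forall p, p \in r -> P p -> sqchar M (x p) (c p)) ->
  sqchar M (\prod_(p <- r | P p) x p) (fun u => \prod_(p <- r | P p) c p u).
Proof.
elim: r => [|p r IHr] H.
  by rewrite big_nil; apply: sqchar_eq (sqchar1 M) => u _; rewrite big_nil.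
have {}IHr : sqchar M (\prod_(p <- r | P p) x p) (fun u => \prod_(p <- r | P p) c p u).
  by apply: IHr => q q_r; apply: H; rewrite inE q_r orbT.
rewrite big_cons; case: ifP => Pp.
  apply: sqchar_eq (sqcharM (H p (mem_head _ _) Pp) IHr) => u _.
  by rewrite big_cons Pp.
by apply: sqchar_eq IHr => u _; rewrite big_cons Pp.
Qed.

(** Both sides are the value at 1 of (X^p - 1)/(X - 1), factored or expanded. *)
Lemma prod_1_sub_root p (z : algC) : p.-primitive_root z ->
  \prod_(1 <= i < p) (1 - z ^+ i) = p%:R.
Proof.
move=> zP; have p_gt0 := prim_order_gt0 zP.
have : \prod_(1 <= i < p) ('X - (z ^+ i)%:P) = \sum_(i < p) 'X^i :> {poly algC}.
  have X1 : 'X - 1%:P != 0 :> {poly algC} by rewrite polyXsubC_eq0.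
  apply: (mulfI X1); rewrite -[in RHS]subrX1 -(factor_Xn_sub_1 zP).
  by rewrite [RHS]big_ltn // expr0.
move/(congr1 (fun q => q.[1])); rewrite /= horner_prod horner_sum => E.
transitivity (\prod_(1 <= i < p) ('X - (z ^+ i)%:P).[1]).
  by apply: eq_bigr => i _; rewrite hornerXsubC.
rewrite E (eq_bigr (fun=> 1)) => [|i _]; last by rewrite hornerXn expr1n.
by rewrite sumr_const card_ord.
Qed.

Lemma legendre_mod u v p : prime p -> p != 2%N -> (u = v %[mod p])%N ->
  legendre u p = legendre v p.
Proof.
move=> pp p2 uv; by rewrite /legendre (negPf p2) /dvdn uv.
Qed.

Definition prime_disc (p : nat) : int := if (p %% 4 == 1)%N then p%:Z else - p%:Z.

(** A rational [S] would be an algebraic integer, hence an integer whose square has p-adic valuation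
    1. *)
Lemma prime_disc_sqrt_irrational p (S : algC) : prime p ->
  S ^+ 2 = (prime_disc p)%:~R -> S \notin Crat.
Proof.
move=> pp S2; apply/negP => S_rat; have S_Aint : S \in Aint.
  apply: (@root_monic_Aint ('X^2 - ((prime_disc p)%:~R)%:P)).
  - by rewrite /root hornerD hornerN hornerXn hornerC S2 subrr.
  - by rewrite monicXnsubC.
  apply/polyOverP => i; rewrite coefB coefXn coefC.
  by rewrite rpredB ?rpred_nat //; case: ifP => _; rewrite ?rpred0 ?rpred_int.
have /intrP[n Sn] := Cint_rat_Aint S_rat S_Aint.
move: S2; rewrite Sn -rmorphXn => /eqP; rewrite eqr_int => /eqP /(congr1 absz).
rewrite abszX => n2.
have {n2} : (`|n| ^ 2 = p)%N by rewrite n2 /prime_disc; case: ifP; rewrite ?abszN absz_nat.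
by move/(congr1 (logn p)); rewrite lognX (logn_prime _ pp) eqxx; case: (logn _ _) => // -[].
Qed.

(** The square root is extracted from p = prod (1 - z^i) by pairing i with p - i. For the action,
    let w generate the units modulo p: if sigma_w fixed [S], every sigma_u would, and [S] would be
    rational. So sigma_w negates [S], and sigma_(w^i) acts by (-1)^i, the Legendre symbol of w^i. *)
Lemma sqchar_prime_disc p : prime p -> odd p ->
  sqchar p (prime_disc p) (fun u => legendre u p).
Proof.
move=> pp p_odd; have p_gt0 := prime_gt0 pp; have zP := zeta_prim p_gt0.
set z := zeta p in zP; pose m := p./2.
have pE : p = m.*2.+1 by rewrite -[LHS]odd_double_half p_odd.
have p2 : p != 2%N by apply: contraTneq p_odd => ->.
pose A := \prod_(i < m) (1 - z ^+ i.+1); pose Z := \prod_(i < m) z ^+ i.+1.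
(* Since 1 - z^(p-i) = - z^(-i) (1 - z^i), the upper half of the product equals (-1)^m A / Z. *)
have AZ : p%:R * Z = (-1) ^+ m * A ^+ 2.
  rewrite -(prod_1_sub_root zP) (@big_cat_nat _ _ _ m.+1) //=; last by rewrite pE ltnS -addnn leq_addr.
  rewrite big_add1 /= big_mkord -/A -{1}[m.+1]add0n big_addn.
  have -> : (p - m.+1 = m)%N by rewrite pE subSS -addnn addnK.
  rewrite big_nat_rev /= big_mkord -mulrA -big_split /= mulrC expr2 mulrA; congr (_ * A).
  rewrite -[in RHS](card_ord m) -prodr_const -big_split /=; apply: eq_bigr => i _.
  rewrite mulrBl mul1r -exprD mulN1r opprB.
  have -> : (0 + m - i.+1 + m.+1 + i.+1 = p)%N by rewrite pE; have := ltn_ord i; lia.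
  by rewrite (prim_expr_order zP).
have Zp : Z ^+ p = 1.
  by rewrite -prodrXl big1 // => i _; rewrite exprAC (prim_expr_order zP) // expr1n.
(* The exponent m is chosen so that S^2 = (-1)^m p Z^(2m+1), where 2m + 1 = p and Z^p = 1. *)
pose S := A * Z ^+ m.
have S2 : S ^+ 2 = (prime_disc p)%:~R.
  have : (-1) ^+ m * S ^+ 2 = p%:R.
    rewrite exprMn mulrA -AZ -mulrA -exprM muln2 -exprS.
    by rewrite -/m -pE Zp mulr1.
  move/(congr1 ( *%R ((-1) ^+ m))); rewrite mulrA -expr2 exprAC sqrrN !expr1n mul1r => ->.
  rewrite /prime_disc -signr_odd; have -> : (p %% 4 == 1)%N = ~~ odd m.
    rewrite {1}pE; have := odd_double_half m; case: (odd m); lia.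
  by case: (odd m); rewrite ?mulN1r ?mul1r ?intrN.
have cyc_S : in_cyclotomic p S.
  apply: in_cyclotomicM; last apply: in_cyclotomicX; apply: in_cyclotomic_prod => i _.
    apply: in_cyclotomicB; [exact: in_cyclotomic1|apply: in_cyclotomicX].
    by apply: in_cyclotomic_root => //; rewrite (prim_expr_order zP).
  by apply/in_cyclotomicX/in_cyclotomic_root; rewrite ?(prim_expr_order zP).
have S_neq0 : S != 0.
  apply/eqP => S0; move/eqP: S2; rewrite S0 expr0n /= eq_sym intr_eq0 /prime_disc.
  by case: ifP; rewrite ?oppr_eq0 (eqz_nat p 0) => _; rewrite gtn_eqF.
exists S; split=> //.
have [P SE] := cyc_S.
have [w [co_w w_gen]] := primitive_root_mod pp.
have [tw twP] := Qn_aut_exists co_w.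
have tS (tau : {rmorphism algC -> algC}) : (tau S == S) || (tau S == - S) :> bool.
  by rewrite -eqf_sqr -rmorphXn S2 rmorph_int.
have gen_act i : (pQtoC P).[z ^+ (w ^ i)] = (if tw S == S then 1 else -1) ^+ i * S.
  elim: i => [|i IHi]; first by rewrite expn0 expr1 expr0 mul1r SE.
  have := congr1 tw IHi; rewrite rmorphM rmorphXn -horner_map -map_poly_comp.
  rewrite (twP (z ^+ _)); last by rewrite exprAC (prim_expr_order zP) ?expr1n.
  rewrite -exprM -expnSr (@eq_map_poly _ _ _ QtoC) => [->|c]; last by rewrite /= fmorph_rat.
  have := tS tw; case: ifP => /= [/eqP -> _|_ /eqP ->].
    by rewrite rmorph1 exprSr mulr1.
  by rewrite rmorphN rmorph1 exprSr mulrN -mulrA !mulN1r mulrN.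
have act u tau : acts_as p tau u -> tau S = (pQtoC P).[z ^+ u].
  by move=> tP; rewrite SE (acts_as_horner _ tP) ?zeta_exp.
have zmod u v : (u = v %[mod p])%N -> z ^+ u = z ^+ v.
  by move=> uv; apply/eqP; rewrite (eq_prim_root_expr zP) uv.
have tw_neq : tw S != S.
  apply/eqP => twS; apply/negP: (prime_disc_sqrt_irrational pp S2); rewrite negbK.
  apply: in_cyclotomic_Crat cyc_S _ => // tau u co tP.
  have [i ui] := w_gen _ co; rewrite (act _ _ tP) (zmod _ _ ui) gen_act twS eqxx.
  by rewrite expr1n mul1r.
have eps i : (pQtoC P).[z ^+ (w ^ i)] = (-1) ^+ odd i * S.
  by rewrite gen_act (negPf tw_neq) signr_odd.
move=> tau u co_u tP; rewrite (act _ _ tP).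
have [i ui] := w_gen _ co_u; rewrite (zmod _ _ ui) eps; congr (_ * _).
move: (co_u); rewrite coprime_sym prime_coprime // /legendre (negPf p2) => /negPf ->.
(* If u = x^2 with x = w^j, then the exponents w^i and w^(2j) give the same conjugate of [S], so i
   is even; conversely w^(i/2) is a square root. *)
have -> : [exists x : 'I_p, x ^ 2 == u %[mod p]]%N = ~~ odd i.
  apply/existsP/idP => [[x /eqP xu]|i_even].
    have co_x : coprime x p.
      by rewrite -(@coprime_pexpl 2) // /coprime -gcdn_modl xu gcdn_modl.
    have [j xj] := w_gen _ co_x.
    apply/negP => odd_i; have : (pQtoC P).[z ^+ (w ^ i)] = (pQtoC P).[z ^+ (w ^ (j * 2))].
      congr (_.[_]); apply: zmod; rewrite -ui -xu expnM.
      by rewrite -[in LHS]modnXm xj modnXm.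
    rewrite !eps odd_i oddM andbF expr0 expr1 mul1r mulN1r => /eqP.
    by rewrite eq_sym -addr_eq0 -mulr2n mulrn_eq0 (negPf S_neq0).
  exists (Ordinal (ltn_pmod (w ^ i./2) p_gt0)); apply/eqP.
  rewrite /= modnXm -expnM muln2 ui.
  by have := odd_double_half i; rewrite (negPf i_even) add0n => ->.
by case: (odd i) => /=; rewrite ?expr1 ?expr0.
Qed.

Definition sign_char (u : nat) : int := if (u %% 4 == 3)%N then -1 else 1.

Lemma sqchar_N1 : sqchar 4 (-1) sign_char.
Proof.
have zP := @zeta_prim 4 isT; set z := zeta 4 in zP.
have z2 : z ^+ 2 = -1.
  have /eqP : (z ^+ 2) ^+ 2 = 1 by rewrite -exprM (prim_expr_order zP).
  by rewrite sqrf_eq1 -(prim_order_dvd zP) => /orP[//|/eqP].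
exists z; split; first by rewrite z2.
  by apply: in_cyclotomic_root => //; rewrite (prim_expr_order zP).
move=> tau u co tP; rewrite tP ?(prim_expr_order zP) // -(prim_expr_mod zP) /sign_char.
have : (u %% 4 = 1 \/ u %% 4 = 3)%N.
  have : odd u by move: co; rewrite (coprimeXr 2) coprimen2 || rewrite -[4%N]/(2 ^ 2)%N coprime_pexpr // coprimen2.
  lia.
by case=> ->; rewrite /= ?expr1 ?mul1r // exprS z2 mulrC.
Qed.

Lemma legendre_2 u : odd u ->
  legendre u 2 = if (u %% 8 == 1)%N || (u %% 8 == 7)%N then 1 else -1.
Proof.
move=> u_odd; rewrite /legendre dvdn2 u_odd /= -signr_odd.
have [k ->] : exists k, u = (k * 8 + u %% 8)%N by exists (u %/ 8)%N; rewrite -divn_eq.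
have : (u %% 8 = 1 \/ u %% 8 = 3 \/ u %% 8 = 5 \/ u %% 8 = 7)%N by lia.
have par r c : (r ^ 2 - 1 = c * 8)%N -> (0 < r)%N ->
   odd (((k * 8 + r) ^ 2 - 1) %/ 8) = odd c.
  move=> rc r_gt0.
  have -> : ((k * 8 + r) ^ 2 - 1 = (k * (k * 8 + r * 2) + c) * 8)%N.
    rewrite mulnDl -rc; move: r_gt0; case: r {rc} => // r _; rewrite !expnS !expn0; nia.
  by rewrite mulnK // oddD oddM oddD !oddM /= !andbF.
by case=> [|[|[]]] ->; rewrite modnMDl ?(par 1 0) ?(par 3 1) ?(par 5 3) ?(par 7 6).
Qed.

Lemma sqchar_2 : sqchar 8 2 (fun u => legendre u 2).
Proof.
have := @zeta_prim 8 isT; move: (zeta 8) => z zP.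
have z4 : z ^+ 4 = -1.
  have /eqP : (z ^+ 4) ^+ 2 = 1 by rewrite -exprM (prim_expr_order zP).
  by rewrite sqrf_eq1 -(prim_order_dvd zP) => /orP[//|/eqP].
(* As z^7 = z^(-1), this is z + z^(-1), a square root of 2. *)
exists (z + z ^+ 7); split.
- have -> : (z + z ^+ 7) ^+ 2 = z ^+ 2 * (1 + z ^+ 4 * z ^+ 8) + 2 * z ^+ 8 by ring.
  by rewrite (prim_expr_order zP) z4 mulr1 subrr mulr0 add0r mulr1.
- apply: in_cyclotomicD; last apply: in_cyclotomicX.
    by apply: in_cyclotomic_root; rewrite ?(prim_expr_order zP).
  by apply: in_cyclotomic_root; rewrite ?(prim_expr_order zP).
move=> tau u co tP.
have u_odd : odd u by move: co; rewrite -[8%N]/(2 ^ 3)%N coprime_pexpr // coprimen2.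
have tz : tau z = z ^+ u by apply: tP; rewrite (prim_expr_order zP).
rewrite legendre_2 // rmorphD [tau (z ^+ 7)]rmorphXn tz.
rewrite -(prim_expr_mod zP u).
have : (u %% 8 = 1 \/ u %% 8 = 3 \/ u %% 8 = 5 \/ u %% 8 = 7)%N by lia.
have z7 : z ^+ 7 = - z ^+ 3 by rewrite (exprD z 4 3) z4 mulN1r.
have z5 : z ^+ 5 = - z by rewrite (exprD z 4 1) z4 mulN1r.
by case=> [|[|[]]] -> /=; rewrite -exprM -(prim_expr_mod zP (_ * _)%N) /= ?z5 ?z7; ring.
Qed.

(** * Quadratic fields inside cyclotomic fields *)

Definition disc_cond (m : int) (M : nat) :=
  [|| (m == 1 %[mod 4])%Z, (m == 2 %[mod 4])%Z && (8 %| M)%N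
    | (m == 3 %[mod 4])%Z && (4 %| M)%N].

(* For squarefree [m], the discriminant of [Q(sqrt m)] divides [M]. *)
Definition disc_dvd (m : int) (M : nat) := (`|m| %| M)%N && disc_cond m M.

(** The Kronecker character of Q(sqrt m) after reciprocity: sqrt m is a product of the sqrt(+-p)
    whose radicand is 1 mod 4, of sqrt 2 when m is even, and of i when the odd part of m is 3 mod 4;
    [sign_char] is the action on i. *)
Definition quad_char (m : int) (u : nat) : int :=
  (if (odd_part m == 1 %[mod 4])%Z then 1 else sign_char u) * jacobi u `|m|.

Lemma jacobi_squarefree u n : squarefree n ->
  jacobi u n = \prod_(p <- primes n) legendre u p.
Proof.
move=> sq; rewrite /jacobi big_seq [RHS]big_seq; apply: eq_bigr => p p_n.
by rewrite squarefree_logn // expr1.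
Qed.

Lemma squarefree_odd_part m : squarefree `|m|%N ->
  m = odd_part m * (if (2 %| `|m|)%N then 2 else 1) /\ odd `|odd_part m|.
Proof.
move=> sq; have m_gt0 := squarefree_gt0 sq; rewrite /odd_part.
case: ifP => m2; last by rewrite lognE m2 andbF expn0 divz1 mulr1; move: m2; lia.
have m2P : 2%N \in primes `|m| by rewrite mem_primes m_gt0.
rewrite (squarefree_logn sq m2P) expn1; move: sq m2 => /andP[_ /allP/(_ _ m2P)]; lia.
Qed.

Lemma big_primes_even (R : Type) (idx : R) (op : Monoid.law idx) n (F : nat -> R) :
  \big[op/idx]_(p <- primes n | ~~ odd p) F p = if 2%N \in primes n then F 2%N else idx.
Proof.
transitivity (\big[op/idx]_(p <- primes n | p == 2%N) F p).
  rewrite big_seq_cond [RHS]big_seq_cond; apply: eq_bigl => p.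
  rewrite mem_primes; case: (boolP (prime p)) => //= pp.
  case: (even_prime pp) => [->//|p_odd]; rewrite p_odd andbF.
  by case: eqP p_odd => [->//|]; rewrite andbF.
rewrite -big_filter; case: ifP => n2.
  by rewrite filter_pred1_uniq ?primes_uniq // big_seq1.
by rewrite (eq_in_filter (a2 := pred0)) ?filter_pred0 ?big_nil // => p; case: eqP => // ->; rewrite n2.
Qed.

Lemma prime_disc_mod4 p : odd p -> (prime_disc p = 1 %[mod 4])%Z.
Proof. by move=> p_odd; rewrite /prime_disc; case: ifP; lia. Qed.

Lemma sqchar_squarefree m M : squarefree `|m|%N -> (0 < M)%N -> disc_dvd m M ->
  sqchar M m (quad_char m).
Proof.
rewrite /disc_dvd /disc_cond => sq M_gt0 /andP[m_M condM].
have [mE o_odd] := squarefree_odd_part sq; set o := odd_part m in mE o_odd *.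
set n := `|m|%N in sq m_M.
pose Q : int := \prod_(p <- primes n | odd p) prime_disc p.
(* Both [o] and [Q] have the same absolute value and [Q] is 1 mod 4, so the sign is read off from
   [o] mod 4. *)
have oQ : o = (if (o == 1 %[mod 4])%Z then 1 else -1) * Q.
  have Q4 : (Q = 1 %[mod 4])%Z.
    rewrite /Q; elim/big_rec: _ => // p x p_odd x1.
    by rewrite -modzMml prime_disc_mod4 // modzMml mul1r.
  have absQ : `|Q|%N = `|o|%N.
    have n_gt0 := squarefree_gt0 sq.
    have := squarefree_prod sq; rewrite (bigID odd) /= big_primes_even mem_primes n_gt0 /=.
    have -> : (\prod_(p <- primes n | odd p) p)%N = `|Q|%N.
      rewrite /Q (big_morph _ abszM absz1); apply: eq_bigr => p _.
      by rewrite /prime_disc; case: ifP; rewrite ?abszN.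
    rewrite {2}/n {1}mE abszM -/n; case: ifP => _; last by rewrite !muln1.
    by move/eqP; rewrite eqn_pmul2r // => /eqP.
  have : o = Q \/ o = - Q by lia.
  by case: ifP; lia.
have cQ : sqchar M Q (fun u => \prod_(p <- primes n | odd p) legendre u p).
  apply: sqchar_prod => p p_n p_odd; move: p_n; rewrite mem_primes => /and3P[pp _ p_n].
  apply: (sqcharS M_gt0 (dvdn_trans p_n m_M)); exact: sqchar_prime_disc.
have c2 : sqchar M (if (2 %| n)%N then 2 else 1) (fun u => if (2 %| n)%N then legendre u 2 else 1).
  case: ifP => n2; last exact: sqchar1.
  by apply: (sqcharS M_gt0 _ sqchar_2); move: condM; rewrite /n in n2; lia.
have c1 : sqchar M (if (o == 1 %[mod 4])%Z then 1 else -1) (fun u => if (o == 1 %[mod 4])%Z then 1 else sign_char u).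
  case: ifP => o1; first exact: sqchar1.
  apply: (sqcharS M_gt0 _ sqchar_N1); move: condM mE; case: ifP; rewrite /n; lia.
have := sqcharM (sqcharM c1 cQ) c2; rewrite -oQ -mE.
apply: sqchar_eq => u _; rewrite /quad_char -/o -/n -mulrA; congr (_ * _).
rewrite jacobi_squarefree // [RHS](bigID odd) /=; congr (_ * _).
by rewrite big_primes_even mem_primes squarefree_gt0.
Qed.

(** Without nonresidues every sigma_u would fix the square root of +-p, which would then be
    rational. *)
Lemma nonresidue_exists p : prime p -> odd p ->
  exists w, coprime w p /\ legendre w p = -1.
Proof.
move=> pp p_odd; have [S [S2 cyc_S tS]] := sqchar_prime_disc pp p_odd.
apply: contra_notP (negP (prime_disc_sqrt_irrational pp S2)) => no_w.
apply: in_cyclotomic_Crat cyc_S _ => [|tau u co tP]; first exact: prime_gt0.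
rewrite (tS _ _ co tP); suff -> : legendre u p = 1 by rewrite mul1r.
have p2 : p != 2%N by apply: contraTneq p_odd => ->.
have : legendre u p <> -1 by move=> u1; apply: no_w; exists u.
move: co; rewrite coprime_sym prime_coprime // /legendre (negPf p2) => /negPf ->.
by case: ifP.
Qed.

Lemma legendre_1 u p : prime p -> (u = 1 %[mod p])%N -> (u = 1 %[mod 8])%N \/ odd p ->
  legendre u p = 1.
Proof.
move=> pp up u8; have [p_odd|p_even] := boolP (odd p).
  have p2 : p != 2%N by apply: contraTneq p_odd => ->.
  rewrite (legendre_mod pp p2 up) /legendre (negPf p2) dvdn1 gtn_eqF ?prime_gt1 //.
  suff -> : [exists x : 'I_p, x ^ 2 == 1 %[mod p]]%N by [].
  by apply/existsP; exists (Ordinal (prime_gt1 pp)); rewrite /= exp1n.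
case: u8 => [u8|]; last by rewrite (negPf p_even).
have -> : p = 2%N by case: (even_prime pp) p_even => // ->.
by rewrite legendre_2 ?u8 //; lia.
Qed.

Lemma mod8_mod4 u r : (u = r %[mod 8])%N -> (u = r %[mod 4])%N.
Proof. by move=> ur; rewrite -(modn_dvdm u (isT : 4 %| 8)%N) ur modn_dvdm. Qed.

(** Produces a Galois element trivial on Q(zeta_N) that negates sqrt m. Either an odd prime of m is
    missing from N, and a nonresidue modulo it serves, or the obstruction is at 2. *)
Lemma quad_char_N1_exists m N : squarefree `|m|%N -> (0 < N)%N -> ~~ disc_dvd m N ->
  exists u, [/\ coprime u (8 * `|m| * N), (u = 1 %[mod N])%N & quad_char m u = -1].
Proof.
move=> sq N_gt0 ndisc; have m_gt0 := squarefree_gt0 sq.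
have [[p [pp p_odd p_m p_N]]|all_p] :=
    EM (exists p, [/\ prime p, odd p, (p %| `|m|)%N & ~~ (p %| N)%N]).
  have [w [co_w w_N1]] := nonresidue_exists pp p_odd.
  pose k := (`|m| %/ p)%N; have mE : `|m|%N = (k * p)%N by rewrite divnK.
  have p_n : p \in primes `|m| by rewrite mem_primes pp m_gt0.
  have k_p : ~~ (p %| k)%N.
    apply: contraL isT => p_k; have /andP[_ /allP/(_ _ p_n)/negP[]] := sq.
    by rewrite mE expnS expn1 dvdn_pmul2r ?prime_gt0.
  have co_M : coprime (8 * k * N) p.
    rewrite coprime_sym prime_coprime // !Euclid_dvdM // !negb_or k_p p_N !andbT.
    by rewrite -[8%N]/(2 ^ 3)%N Euclid_dvdX // dvdn_prime2 // andbT; apply: contraTneq p_odd => ->.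
  (* Being 1 mod 8 makes the sign and the symbol at 2 trivial, being 1 mod k the symbols at the
     other primes of m; only the symbol at p survives. *)
  pose u := chinese (8 * k * N) p 1 w.
  have u1 : (u = 1 %[mod 8 * k * N])%N by apply: chinese_modl.
  have uw : (u = w %[mod p])%N by apply: chinese_modr.
  have u1d d : (d %| 8 * k * N)%N -> (u = 1 %[mod d])%N.
    by move=> dM; rewrite -(modn_dvdm u dM) u1 modn_dvdm.
  have u8 : (u = 1 %[mod 8])%N by apply: u1d; rewrite -mulnA dvdn_mulr.
  exists u; split.
  - rewrite mE mulnA mulnAC coprimeMr; apply/andP; split.
      by rewrite /coprime -gcdn_modl u1 gcdn_modl gcd1n.
    by rewrite /coprime -gcdn_modl uw gcdn_modl.
  - by apply: u1d; rewrite dvdn_mull.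
  rewrite /quad_char /sign_char.
  rewrite (mod8_mod4 u8) /=.
  rewrite if_same mul1r jacobi_squarefree // (bigD1_seq p) ?primes_uniq //=.
  rewrite (legendre_mod pp _ uw) ?w_N1; last by apply: contraTneq p_odd => ->.
  rewrite big_seq_cond big1 ?mulr1 // => q /andP[].
  rewrite mem_primes => /and3P[qq _ q_m] q_p; apply: legendre_1; [by []| |by left].
  apply: u1d; rewrite dvdn_mulr // dvdn_mull //.
  by move: q_m; rewrite mE Euclid_dvdM // (dvdn_prime2 qq pp) (negPf q_p) orbF.
have {}all_p p : prime p -> odd p -> (p %| `|m|)%N -> (p %| N)%N.
  by move=> pp p_odd p_m; apply: contrapT => /negP p_N; apply: all_p; exists p.
pose T := (N`_2^')%N; have NE : N = (N`_2 * T)%N by rewrite partnC.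
have T_odd : odd T by rewrite -coprimen2 coprime_sym (pnat_coprime (pi := 2%N)) ?part_pnat // pnat_id.
have coT : coprime T 8 by rewrite -[8%N]/(2 ^ 3)%N coprime_pexpr // coprimen2.
(* For odd m the failure of the criterion leaves m = 3 mod 4 with 4 not dividing N: 3 is 1 mod 2 and
   negates i. For even m it leaves 8 not dividing N: 5 is 1 mod 4, fixes i and negates sqrt 2. *)
pose r := if odd `|m| then 3%N else 5%N.
pose u := chinese T 8 1 r.
have u1 : (u = 1 %[mod T])%N by apply: chinese_modl.
have ur : (u = r %[mod 8])%N by apply: chinese_modr.
have u_odd : odd u by move: ur; rewrite /r; case: ifP => _; clear; lia.
have m_2N : (`|m| %| 2 * N)%N.
  apply/squarefree_dvdP => // p pp p_m; case: (even_prime pp) => [->|p_odd]; first exact: dvdn_mulr.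
  by apply: dvdn_mull; apply: all_p.
have m_N : (odd `|m| || (2 %| N)%N) -> (`|m| %| N)%N.
  move=> m_odd; apply/squarefree_dvdP => // p pp p_m.
  case: (even_prime pp) => [p2|p_odd]; last exact: all_p.
  by move: m_odd p_m; rewrite p2 [(2 %| `|m|)%N]dvdn2; case: (odd `|m|).
have m4 : ~~ (4 %| `|m|)%N.
  have [m2|m2] := boolP (2%N \in primes `|m|); first by have /andP[_ /allP/(_ _ m2)] := sq.
  by apply: contra m2 => /(dvdn_trans _) m2; rewrite mem_primes m_gt0 m2.
pose e := logn 2 N; have N2 : (N`_2)%N = (2 ^ e)%N by rewrite p_part.
have eP k : (2 ^ k %| N)%N = (k <= e)%N by rewrite pfactor_dvdn.
have odd_p q : prime q -> odd q -> (q %| `|m|)%N -> legendre u q = 1.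
  move=> qq q_odd q_m; apply: legendre_1; [by []| |by right].
  have q_T : (q %| T)%N.
    have := all_p _ qq q_odd q_m; rewrite {1}NE Euclid_dvdM // N2.
    rewrite Euclid_dvdX // (dvdn_prime2 qq) // => /orP[/andP[/eqP q2]|//].
    by rewrite q2 in q_odd.
  by rewrite -(modn_dvdm u q_T) u1 modn_dvdm.
have jac : jacobi u `|m| = if odd `|m| then 1 else legendre u 2.
  rewrite jacobi_squarefree // (bigID odd) /= big_primes_even.
  rewrite big_seq_cond big1 => [|q /andP[]]; last first.
    by rewrite mem_primes => /and3P[qq _ q_m] q_odd; apply: odd_p.
  by rewrite mul1r mem_primes m_gt0 /= dvdn2; case: odd.
have u1N : (u = 1 %[mod N])%N.
  rewrite NE; apply/eqP; rewrite chinese_remainder ?u1 ?eqxx ?andbT; last first.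
    by rewrite N2 coprimeXl // coprime2n.
  have e_small : (if odd `|m| then (e <= 1)%N else (e <= 2)%N).
    rewrite leqNgt -(eP 2%N) [(e <= 2)%N]leqNgt -(eP 3%N) /=.
    move: ndisc; rewrite /disc_dvd /disc_cond; case: ifP => m_odd.
      rewrite m_N ?m_odd //=; move: m_odd; clear; lia.
    have [N8|//] := boolP (2 ^ 3 %| N)%N; rewrite m_N; last by rewrite (dvdn_trans _ N8) ?orbT.
    by case/negP; move: m_odd m4; clear; lia.
  rewrite N2; move: ur e_small; rewrite /r; case: ifP => _; case: (e) => [|[|[|]]] //; clear; lia.
exists u; split => //.
- rewrite !coprimeMr; have co_N : coprime u N by rewrite /coprime -gcdn_modl u1N gcdn_modl gcd1n.
  rewrite co_N andbT -[8%N]/(2 ^ 3)%N coprime_pexpr // coprimen2 u_odd /=.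
  by apply: coprime_dvdr m_2N _; rewrite coprimeMr coprimen2 u_odd.
have [mE o_odd] := squarefree_odd_part sq.
rewrite /quad_char jac /sign_char (mod8_mod4 ur) /r.
case: (boolP (odd `|m|)) => m_odd /=; last first.
  by rewrite if_same mul1r legendre_2 // ur /r (negPf m_odd).
rewrite mulr1; case: ifP => // o1; move: ndisc; rewrite /disc_dvd /disc_cond m_N ?m_odd //=.
by move: mE; rewrite dvdn2 m_odd /= mulr1 => ->; rewrite o1.
Qed.

(** At the larger level 8 |m| N the square root is cyclotomic and its character is known; an
    automorphism that is trivial on Q(zeta_N) but negates this root also negates [x]. *)
Lemma sqrt_notin_cyclotomic m N (x : algC) : squarefree `|m|%N -> (0 < N)%N ->
  ~~ disc_dvd m N -> x ^+ 2 = m%:~R -> ~ in_cyclotomic N x.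
Proof.
move=> sq N_gt0 ndisc x2 cyc_x; have m_gt0 := squarefree_gt0 sq.
have [u [co_u u1 char_u]] := quad_char_N1_exists sq N_gt0 ndisc.
set M := (8 * `|m| * N)%N in co_u.
have M_gt0 : (0 < M)%N by rewrite !muln_gt0 m_gt0.
have m4 : ~~ (4 %| `|m|)%N.
  have [m2|m2] := boolP (2%N \in primes `|m|); first by have /andP[_ /allP/(_ _ m2)] := sq.
  by apply: contra m2 => /(dvdn_trans _) m2; rewrite mem_primes m_gt0 m2.
have discM : disc_dvd m M.
  rewrite /disc_dvd /disc_cond /M -mulnA dvdn_mull ?dvdn_mulr //=.
  by move: m4; clear; lia.
have [S [S2 _ tS]] := sqchar_squarefree sq M_gt0 discM.
have [tau tP] := Qn_aut_exists co_u.
have tPN : acts_as N tau u by apply: acts_asS tP; rewrite dvdn_mull.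
have tx : tau x = x.
  apply: acts_as_id cyc_x => w wN; rewrite tPN //.
  by rewrite -(expr_mod _ wN) u1 (expr_mod _ wN).
have x_neq0 : x != 0.
  apply/eqP => x0; move/eqP: x2; rewrite x0 expr0n /= eq_sym intr_eq0 => /eqP m0.
  by move: m_gt0; rewrite m0.
have xN : x != - x by rewrite -addr_eq0 -mulr2n mulrn_eq0.
have tSN : tau S = - S by rewrite (tS _ _ co_u tP) char_u mulN1r.
have /eqP : x ^+ 2 = S ^+ 2 by rewrite x2 S2.
rewrite eqf_sqr => /orP[] /eqP xS; move: xN; rewrite -{1}tx xS ?rmorphN /= tSN ?opprK eqxx //.
Qed.

(** * Roots of rational numbers over cyclotomic fields *)

Lemma conj_acts_as M : (0 < M)%N -> acts_as M Num.conj M.-1.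
Proof.
move=> M_gt0 w wM; have w1 := unity_normC M_gt0 wM.
have w0 : w != 0 by rewrite -normr_eq0 w1 oner_eq0.
apply: (mulfI w0); rewrite -exprS prednK // wM.
by transitivity (`|w| ^+ 2); [rewrite normCK | rewrite w1 expr1n].
Qed.

Lemma real_odd_expr_inj n (x y : algC) : odd n ->
  x \is Num.real -> y \is Num.real -> x ^+ n = y ^+ n -> x = y.
Proof.
move=> n_odd Rx Ry xy; have n_gt0 : (0 < n)%N by case: n n_odd {xy}.
have [y0|y_neq0] := eqVneq y 0.
  by apply/eqP; move/eqP: xy; rewrite y0 expr0n gtn_eqF // expf_eq0 n_gt0.
pose w := x / y; have wn : w ^+ n = 1 by rewrite expr_div_n xy divff // expf_neq0.
have Rw : w \is Num.real by rewrite rpred_div.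
have : w ^+ 2 == 1 by rewrite -real_normK // (unity_normC n_gt0 wn) expr1n.
rewrite sqrf_eq1 => /orP[] /eqP w1; first by rewrite -[x](mulfVK y_neq0) -/w w1 mul1r.
by move/eqP: wn; rewrite w1 -signr_odd n_odd expr1 -subr_eq0 -opprD oppr_eq0 (pnatr_eq0 _ 2).
Qed.

Lemma real_odd_root n (g : rat) : odd n ->
  exists2 x : algC, x \is Num.real & x ^+ n = ratr g.
Proof.
move=> n_odd; have n_gt0 : (0 < n)%N by case: n n_odd.
have posP (c : rat) : 0 <= c -> exists2 x : algC, x \is Num.real & x ^+ n = ratr c.
  move=> c_ge0; exists (n.-root (ratr c)); last by rewrite rootCK.
  by rewrite ger0_real // rootC_ge0 // ler0q.
have [|g_lt0] := leP 0 g; first exact: posP.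
have [|x Rx xn] := posP (- g); first by rewrite oppr_ge0 ltW.
exists (- x); first by rewrite rpredN.
by rewrite exprNn -signr_odd n_odd expr1 mulN1r xn rmorphN opprK.
Qed.

(* Complex conjugation commutes with the automorphisms of a cyclotomic field,
   so that the conjugates of a real [p]-th root of [g] are real, hence all
   equal to it. *)
Lemma odd_root_in_cyclotomic (g : rat) p N (r : algC) : odd p -> (0 < N)%N -> (p %| N)%N ->
  r ^+ p = ratr g -> in_cyclotomic N r -> exists s : rat, g = s ^+ p.
Proof.
move=> p_odd N_gt0 p_N rp cyc_r; have p_gt0 : (0 < p)%N by case: p p_odd {p_N rp}.
have [g0|g_neq0] := eqVneq g 0; first by exists 0; rewrite expr0n gtn_eqF.
have r_neq0 : r != 0.
  by apply: contra_eq_neq rp => ->; rewrite expr0n gtn_eqF // eq_sym fmorph_eq0.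
have [x Rx xp] := real_odd_root g p_odd.
have cyc_x : in_cyclotomic N x.
  rewrite -[x](mulfVK r_neq0); apply: in_cyclotomicM cyc_r.
  apply: (in_cyclotomicS N_gt0 p_N); apply: in_cyclotomic_root => //.
  by rewrite expr_div_n xp rp divff // fmorph_eq0.
have /CratP[s xs] : x \in Crat.
  apply: (in_cyclotomic_Crat _ cyc_x) => // tau u _ tP.
  apply: (real_odd_expr_inj p_odd) => //; last by rewrite -rmorphXn xp fmorph_rat.
  apply/CrealP; rewrite -(acts_as_comm tP (conj_acts_as N_gt0)) //.
  by congr (tau _); apply/CrealP.
by exists s; move: xp; rewrite xs -rmorphXn => /fmorph_inj.
Qed.

(** * Pure extensions of Q(zeta_N) of squarefree exponent n dividing N *)

Section PureExtension.
Variables (L : fieldExtType rat) (inj : {rmorphism L -> algC}) (z r : L) (N n : nat).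
Hypotheses (N_gt0 : (0 < N)%N) (n_sqf : squarefree n) (n_N : (n %| N)%N).
Hypotheses (inj_z : inj z = zeta N) (r_neq0 : r != 0) (rn : r ^+ n \in 1%VS).
Let E := <<1; z>>%AS.
Let n_gt0 : (0 < n)%N. Proof. exact: squarefree_gt0. Qed.
Let zP : N.-primitive_root z.
Proof. by rewrite -(fmorph_primitive_root inj) inj_z zeta_prim. Qed.

Lemma inj_horner (p : {poly rat}) w :
  inj (map_poly (in_alg L) p).[w] = (pQtoC p).[inj w].
Proof.
rewrite -horner_map -map_poly_comp; congr (_.[_]).
by apply: eq_map_poly => c /=; rewrite alg_num_field fmorph_rat.
Qed.

Lemma mem_cyclotomicP x : reflect (in_cyclotomic N (inj x)) (x \in E).
Proof.
apply: (iffP idP) => [/Fadjoin_polyP[_ /polyOver1P[p ->] ->]|[p xE]].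
  by exists p; rewrite inj_horner inj_z.
apply/Fadjoin_polyP; exists (map_poly (in_alg L) p); first by apply/polyOver1P; exists p.
by apply: (fmorph_inj inj); rewrite xE inj_horner inj_z.
Qed.

(** The minimal polynomial computed inside [L] and the N-th cyclotomic polynomial of [algC] have
    equal size, since each vanishes at the root of the other after transport along [inj]. *)
Lemma dim_cyclotomic : \dim E = totient N.
Proof.
have zetaP := zeta_prim N_gt0.
have [q [Dq q_mon] q_root] := minCpolyP (zeta N).
have size_q : size q = (totient N).+1.
  by rewrite -(size_map_poly QtoC) -Dq (minCpoly_cyclotomic zetaP) size_cyclotomic.
rewrite dim_Fadjoin dimv1 muln1; apply/eqP; rewrite -eqSS -size_minPoly -size_q.
have [p Dp] := polyOver1P (minPolyOver 1 z).
have p_neq0 : p != 0.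
  by apply: contraTneq (monic_minPoly 1 z) => p0; rewrite Dp p0 rmorph0 monicE lead_coef0 eq_sym oner_eq0.
rewrite eqn_leq; apply/andP; split.
  rewrite -[size q](size_map_poly (in_alg L)); apply: dvdp_leq.
    by rewrite map_poly_eq0 monic_neq0.
  apply: minPoly_dvdp; first by apply/polyOver1P; exists q.
  by rewrite /root -(fmorph_eq0 inj) inj_horner inj_z -/(root _ _) q_root.
rewrite Dp size_map_poly; apply: dvdp_leq => //; rewrite -q_root.
by rewrite /root -inj_z -inj_horner -Dp (rootP (root_minPoly _ _)) rmorph0.
Qed.

Local Notation d := (adjoin_degree E r).

Let w := z ^+ (N %/ n).
Let wP : n.-primitive_root w. Proof. exact: dvdn_prim_root. Qed.
Let wE i : w ^+ i \in E. Proof. by rewrite !rpredX // memv_adjoin. Qed.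

Lemma pure_factorization : 'X^n - (r ^+ n)%:P = \prod_(x <- [seq r * w ^+ i | i <- iota 0 n]) ('X - x%:P).
Proof.
rewrite {1}(@all_roots_prod_XsubC _ ('X^n - (r ^+ n)%:P) [seq r * w ^+ i | i <- iota 0 n]).
- by rewrite (monicP _) ?scale1r // monicXnsubC.
- by rewrite size_XnsubC // size_map size_iota.
- apply/allP => _ /mapP[i _ ->]; rewrite /root hornerD hornerN hornerXn hornerC.
  by rewrite exprMn exprAC (prim_expr_order wP) expr1n mulr1 subrr.
rewrite uniq_rootsE map_inj_in_uniq ?iota_uniq // => i j.
rewrite !mem_iota /= add0n => i_n j_n /(mulfI r_neq0)/eqP.
by rewrite (eq_prim_root_expr wP) !modn_small // => /eqP.
Qed.

(** The constant term of the minimal polynomial lies in [E] and is, up to sign, a product of d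
    conjugates r w^i, that is r^d times a power of w, and w is in [E]. *)
Lemma pure_degree_mem : r ^+ d \in E.
Proof.
have : minPoly E r %| 'X^n - (r ^+ n)%:P.
  apply: minPoly_dvdp; last by rewrite /root hornerD hornerN hornerXn hornerC subrr.
  by rewrite rpredB ?rpredX ?polyOverX // polyOverC (subvP (sub1v _)).
rewrite pure_factorization => /dvdp_prod_XsubC[m]; rewrite eqp_monic ?monic_minPoly ?monic_prod_XsubC // => /eqP Dm.
set t := mask m _ in Dm.
have size_t : size t = d.
  by have := size_minPoly E r; rewrite Dm size_prod_XsubC => -[].
have : (minPoly E r)`_0 \in E by apply: (polyOverP (minPolyOver E r)).
rewrite -horner_coef0 Dm horner_prod -size_t.
have [j ->] : exists j, \prod_(x <- t) ('X - x%:P).[0] = (-1) ^+ size t * r ^+ size t * w ^+ j.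
  have : {subset t <= [seq r * w ^+ i | i <- iota 0 n]} by move=> x; apply: mem_mask.
  elim: t {Dm size_t} => [_|x t IHt t_rs]; first by exists 0%N; rewrite big_nil /= !expr0 !mulr1.
  have [|j Dj] := IHt; first by move=> y y_t; apply: t_rs; rewrite inE y_t orbT.
  have /mapP[i _ ->] := t_rs x (mem_head _ _).
  exists (i + j)%N; rewrite big_cons Dj hornerXsubC sub0r /= !exprS exprD; ring.
move=> H; have -> : r ^+ size t = (-1) ^+ size t * ((-1) ^+ size t * r ^+ size t * w ^+ j) / w ^+ j.
  rewrite !mulrA -exprD addnn -mul2n exprM sqrrN !expr1n mul1r mulfK //.
  by rewrite expf_neq0 // (prim_root_eq0 wP) -lt0n.
by rewrite rpred_div // rpredM // rpredX // rpredN mem1v.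
Qed.

(** The degree is the order of r modulo the units of [E]: a nonzero remainder k mod d would give a
    binomial over [E] of degree less than d vanishing at r. *)
Lemma pure_degree_dvd k : (r ^+ k \in E) = (d %| k)%N.
Proof.
have d_gt0 : (0 < d)%N by [].
apply/idP/idP => [rk|/dvdnP[j ->]]; last by rewrite mulnC exprM rpredX // pure_degree_mem.
rewrite /dvdn -leqn0 leqNgt; apply/negP => k_gt0.
have : r ^+ (k %% d) \in E.
  have -> : r ^+ (k %% d) = r ^+ k / (r ^+ d) ^+ (k %/ d).
    apply: (canRL (mulfK _)); rewrite ?expf_neq0 //.
    by rewrite -exprM mulnC -exprD addnC -divn_eq.
  by rewrite rpred_div // rpredX // pure_degree_mem.
move=> rE; have := @minPoly_dvdp _ _ E r ('X^(k %% d) - (r ^+ (k %% d))%:P).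
rewrite rpredB ?rpredX ?polyOverX ?polyOverC // => /(_ isT).
rewrite /root hornerD hornerN hornerXn hornerC subrr eqxx => /(_ isT)/dvdp_leq.
rewrite -size_poly_eq0 size_XnsubC // size_minPoly => /(_ isT).
by rewrite ltnS leqNgt ltn_mod.
Qed.

Lemma minPoly_pure : minPoly E r = 'X^d - (r ^+ d)%:P.
Proof.
apply/eqP; rewrite -eqp_monic ?monic_minPoly ?monicXnsubC // -dvdp_size_eqp.
  by rewrite size_minPoly size_XnsubC.
apply: minPoly_dvdp; last by rewrite /root hornerD hornerN hornerXn hornerC subrr.
by rewrite rpredB ?rpredX ?polyOverX ?polyOverC // pure_degree_mem.
Qed.

Lemma pure_degree_dvdn : (d %| n)%N.
Proof. by rewrite -pure_degree_dvd (subvP (sub1v _)). Qed.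

(** Since p^2 does not divide n, the divisor d of n divides n/p exactly when p does not divide d. *)
Lemma prime_dvd_pure_degree p : prime p -> (p %| n)%N ->
  (p %| d)%N = (r ^+ (n %/ p) \notin E).
Proof.
move=> pp p_n; have [k nE] := dvdnP pure_degree_dvdn.
have p_gt0 := prime_gt0 pp.
have pn : p \in primes n by rewrite mem_primes pp n_gt0 p_n.
have n_pp : ~~ (p * p %| n)%N by have /andP[_ /allP/(_ _ pn)] := n_sqf.
rewrite pure_degree_dvd; apply/idP/idP => [p_d|].
  apply: contra n_pp => d_np; rewrite -(divnK p_n) mulnC dvdn_pmul2l //.
  exact: dvdn_trans d_np.
apply: contraR => p_d; rewrite dvdn_divRL // mulnC.
by rewrite Gauss_dvd ?p_n ?pure_degree_dvdn // prime_coprime.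
Qed.

Lemma pure_degreeE : d = (\prod_(p <- primes n | r ^+ (n %/ p) \notin E) p)%N.
Proof.
rewrite -[LHS](squarefree_prod (squarefree_dvd n_sqf pure_degree_dvdn)).
rewrite -[RHS]big_filter; apply: perm_big; apply: uniq_perm; rewrite ?filter_uniq ?primes_uniq //.
move=> p; rewrite mem_filter !mem_primes n_gt0 /=.
have [pp|] := boolP (prime p); last by rewrite andbF.
have [p_n|p_n] /= := boolP (p %| n)%N; first by rewrite (prime_dvd_pure_degree pp p_n) andbT.
by rewrite andbF; apply: contraNF p_n => /dvdn_trans-> //; apply: pure_degree_dvdn.
Qed.

Hypothesis gen_r : <<E; r>>%VS = fullv.

Lemma dim_pure : \dim {:L} = (d * totient N)%N.
Proof. by rewrite -gen_r dim_Fadjoin dim_cyclotomic. Qed.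

(** The minimal polynomial of r over [E] is X^d - r^d; once [tau0] fixes r^d this polynomial is
    invariant, so the restriction of [tau0] to [E] extends to [L] by sending r to itself, and then
    to [algC]. *)
Lemma extend_fixing_root tau0 u : acts_as N tau0 u ->
    tau0 (inj (r ^+ d)) = inj (r ^+ d) ->
  exists2 tau, acts_as N tau u & tau (inj r) = inj r.
Proof.
move=> tP fix_rd.
have zN : zeta N ^+ N = 1 := zeta_exp N.
have hom1 : kHom 1 1 (\1%VF : 'End(L)) by rewrite kHom1.
have map_id (p : {poly L}) : map_poly (\1%VF : 'End(L)) p = p.
  by apply/polyP => i; rewrite coef_map /= id_lfunE.
have [p Dp] := polyOver1P (minPolyOver 1 z).
have root_zu : root (map_poly (\1%VF : 'End(L)) (minPoly 1 z)) (z ^+ u).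
  rewrite map_id Dp /root -(fmorph_eq0 inj) inj_horner rmorphXn inj_z.
  by rewrite -(acts_as_horner p tP zN) -inj_z -inj_horner -Dp (rootP (root_minPoly _ _)) !rmorph0.
pose phi := kHomExtend 1 \1 z (z ^+ u).
have hom_phi : kHom 1 E phi := kHomExtendP (subvv _) hom1 root_zu.
have phiE x : x \in E -> inj (phi x) = tau0 (inj x).
  move=> /Fadjoin_polyP[_ /polyOver1P[q ->] ->].
  rewrite (kHomExtend_poly hom1 root_zu); last by apply/polyOver1P; exists q.
  by rewrite map_id !inj_horner rmorphXn inj_z (acts_as_horner q tP zN).
have root_r : root (map_poly phi (minPoly E r)) r.
  rewrite minPoly_pure raddfB /= map_polyC /=.
  have -> : map_poly phi 'X^d = 'X^d.
    by rewrite (kHom_poly_id hom_phi) // rpredX // polyOverX.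
  have -> : phi (r ^+ d) = r ^+ d.
    by apply: (fmorph_inj inj); rewrite phiE ?pure_degree_mem // fix_rd.
  by rewrite /root hornerD hornerN hornerXn hornerC subrr.
pose psi := kHomExtend E phi r r.
have hom_psi : kHom 1 <<E; r>> psi := kHomExtendP (sub1v _) hom_phi root_r.
rewrite gen_r in hom_psi; have /kHom_monoid_morphism psiM := hom_psi.
pose psi_mixin := GRing.isMonoidMorphism.Build _ _ psi psiM.
pose psiRM : {rmorphism _ -> _} := HB.pack (fun_of_lfun psi) psi_mixin.
have [tau Dtau] := extend_algC_subfield_aut inj psiRM.
exists tau; last by rewrite -Dtau /= (kHomExtend_val hom_phi root_r).
move=> _ /(prim_rootP (zeta_prim N_gt0))[i ->].
rewrite rmorphXn /= exprAC -inj_z -Dtau /= kHomExtend_id ?memv_adjoin //.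
by rewrite (kHomExtend_val hom1 root_zu) rmorphXn.
Qed.

End PureExtension.

(** * The fields Q(zeta_f, zeta_n, g^(1/n)) *)

(** Bezout for the coprime cofactors N/f and N/n: zeta_N^(N/f) is a power of zeta_f and zeta_N^(N/n)
    a power of zeta_n. *)
Lemma zeta_lcm f n : (0 < f)%N -> (0 < n)%N ->
  exists i j, zeta (lcmn f n) = zeta f ^+ i * zeta n ^+ j.
Proof.
move=> f_gt0 n_gt0; set N := lcmn f n.
have f_N : (f %| N)%N := dvdn_lcml f n; have n_N : (n %| N)%N := dvdn_lcmr f n.
have N_gt0 : (0 < N)%N by rewrite lcmn_gt0 f_gt0.
have zN : zeta N ^+ N = 1 := zeta_exp N.
have [i0 iE] : {i : 'I_f | zeta N ^+ (N %/ f) = zeta f ^+ i}.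
  by apply: prim_rootP (zeta_prim f_gt0) _ _; rewrite -exprM divnK.
have [j0 jE] : {j : 'I_n | zeta N ^+ (N %/ n) = zeta n ^+ j}.
  by apply: prim_rootP (zeta_prim n_gt0) _ _; rewrite -exprM divnK.
have co : coprime (N %/ f) (N %/ n).
  have d_gt0 : (0 < gcdn f n)%N by rewrite gcdn_gt0 f_gt0.
  have [/dvdnP[f' fE] /dvdnP[n' nE]] := (dvdn_gcdl f n, dvdn_gcdr f n).
  have /eqP NE : (N * gcdn f n == f * n)%N by rewrite muln_lcm_gcd.
  have -> : (N %/ f = n')%N.
    apply/eqP; rewrite -(eqn_pmul2r f_gt0) divnK // -(eqn_pmul2r d_gt0) NE mulnC {1}nE.
    by rewrite mulnAC.
  have -> : (N %/ n = f')%N.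
    apply/eqP; rewrite -(eqn_pmul2r n_gt0) divnK // -(eqn_pmul2r d_gt0) NE {1}fE.
    by rewrite mulnAC.
  by rewrite coprime_sym /coprime -(eqn_pmul2r d_gt0) mul1n muln_gcdl -fE -nE.
have Nf_gt0 : (0 < N %/ f)%N by rewrite divn_gt0 // dvdn_leq.
case: (egcdnP (N %/ n) Nf_gt0) => x y xy _.
(* Here [N.-1 * y] stands for -y, exponents of [zeta N] being taken mod N. *)
exists (i0 * x)%N, (j0 * (N.-1 * y))%N.
move: zN iE jE; move: (zeta N) (zeta f) (zeta n) => z zf zn zN iE jE.
rewrite !exprM -iE -jE -!exprM -exprD.
rewrite [(N %/ f * x)%N]mulnC xy (eqP co : gcdn _ _ = 1%N).
have -> : (y * (N %/ n) + 1 + N %/ n * (N.-1 * y) = N * (N %/ n * y) + 1)%N.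
  have aux M q : (0 < M -> y * q + 1 + q * (M.-1 * y) = M * (q * y) + 1)%N by case: M => // M _; nia.
  exact: aux.
by rewrite exprD exprM zN expr1n mul1r expr1.
Qed.

Lemma agree_adjoin (L : fieldExtType rat) (K : {subfield L}) (phi psi : {rmorphism L -> algC}) x :
  {in K, phi =1 psi} -> phi x = psi x -> {in <<K; x>>%VS, phi =1 psi}.
Proof.
move=> eqK eqx _ /Fadjoin_polyP[q Kq ->]; rewrite -!horner_map eqx; congr (_.[_]).
by apply/polyP => i; rewrite !coef_map /=; apply: eqK; apply: (polyOverP Kq).
Qed.

Lemma agree_adjoin_seq (L : fieldExtType rat) (phi psi : {rmorphism L -> algC}) (s : seq L) :
  {in s, phi =1 psi} -> {in <<1 & s>>%VS, phi =1 psi}.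
Proof.
have eq1 : {in 1%AS, phi =1 psi}.
  by move=> _ /vlineP[c ->]; rewrite alg_num_field !fmorph_rat.
suff H (K : {subfield L}) : {in K, phi =1 psi} -> {in s, phi =1 psi} ->
  {in <<K & s>>%VS, phi =1 psi} by apply: H eq1.
elim: s K => [|x s IHs] K eqK eqs; first by rewrite Fadjoin_nil.
rewrite adjoin_cons; apply: (IHs <<K; x>>%AS) => [|y y_s].
  by apply: agree_adjoin => //; apply: eqs; rewrite mem_head.
by apply: eqs; rewrite inE y_s orbT.
Qed.

Lemma adj_mem s x : x \in s -> exists y, adj_inj s y = x.
Proof. by rewrite -{1}(adj_gensE s) => /mapP[y _ ->]; exists y. Qed.

Lemma in_cyclotomic_adj s n x : zeta n \in s -> in_cyclotomic n x ->
  exists y, adj_inj s y = x.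
Proof.
move=> /adj_mem[z zE] [p ->]; exists (map_poly (in_alg (adj s)) p).[z].
by rewrite inj_horner zE.
Qed.

Lemma fix_adj s (tau : {rmorphism algC -> algC}) y :
  {in s, tau =1 id} -> tau (adj_inj s y) = adj_inj s y.
Proof.
move=> fix_s; have : y \in <<1 & adj_gens s>>%VS by rewrite adj_gens_full memvf.
move: y; apply: (@agree_adjoin_seq _ (tau \o adj_inj s) (adj_inj s)) => x x_s.
by rewrite /= fix_s // -[in X in _ \in X](adj_gensE s) map_f.
Qed.

(** Identifies the abstract [sigma] with the restriction of any automorphism of [algC] raising f-th
    roots of unity to the power a: both are determined by the image of the generator. *)
Lemma adj_inj_sigma a f (af : coprime a f) tau x : acts_as f tau a ->
  adj_inj _ (sigma af x) = tau (adj_inj _ x).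
Proof.
move=> tP; have [p xE] := cyclo_horner x.
have zE : sigma af (cyclo_gen f) = cyclo_gen f ^+ a by rewrite /sigma; case: sigma_exists.
have {}xE : x = (map_poly (in_alg (cyclo f)) p).[cyclo_gen f].
  by apply: (fmorph_inj (adj_inj _)); rewrite inj_horner cyclo_genE.
have -> : sigma af x = (map_poly (in_alg (cyclo f)) p).[cyclo_gen f ^+ a].
  rewrite {1}xE -horner_map zE -map_poly_comp; congr (_.[_]).
  by apply: eq_map_poly => c /=; rewrite alg_num_field fmorph_rat.
rewrite xE !inj_horner rmorphXn /= cyclo_genE (acts_as_horner p tP) //; exact: zeta_exp.
Qed.

(** * Euler products *)

Section SquarefreeSums.
Variable R : realType.
Implicit Types (x y e : nat -> R) (s : seq nat).
Local Open Scope classical_set_scope.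

Definition primes_below N := [seq p <- index_iota 0 N | prime p].

Lemma mem_primes_below N p : (p \in primes_below N) = prime p && (p < N)%N.
Proof. by rewrite mem_filter mem_index_iota. Qed.

Lemma primes_below_uniq N : uniq (primes_below N).
Proof. exact/filter_uniq/iota_uniq. Qed.

Lemma primes_below_prime N : all prime (primes_below N).
Proof. exact: filter_all. Qed.

Fixpoint subproducts s : seq nat :=
  if s is p :: s' then subproducts s' ++ [seq (p * n)%N | n <- subproducts s'] else [:: 1%N].

Lemma squarefree_mul_prime p k : prime p -> squarefree k -> ~~ (p %| k)%N -> squarefree (p * k).
Proof.
move=> pp sqk p_k; have k_gt0 := squarefree_gt0 sqk.
rewrite /squarefree muln_gt0 prime_gt0 // k_gt0 /=; apply/allP => q.
rewrite mem_primes => /and3P[qq _ q_pk]; rewrite pfactor_dvdn ?muln_gt0 ?(prime_gt0 pp) ?k_gt0 //.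
rewrite (lognM _ (prime_gt0 pp) k_gt0) (logn_prime _ pp); case: eqP => [->|_].
  by rewrite (lognE p k) pp k_gt0 (negPf p_k).
have [q_k|q_k] := boolP (q \in primes k); first by rewrite (squarefree_logn sqk q_k).
by rewrite -leqNgt; have := q_k; rewrite -logn_gt0 -eqn0Ngt => /eqP ->.
Qed.

Lemma mem_subproducts s n : uniq s -> all prime s ->
  (n \in subproducts s) = squarefree n && all (mem s) (primes n).
Proof.
elim: s n => [|p s IHs] n /=.
  move=> _ _; rewrite inE; apply/eqP/andP => [->//|[sq]].
  by rewrite -[RHS]/1%N -{2}(squarefree_prod sq); case: (primes n) => [|q r]; rewrite ?big_nil.
case/andP=> p_s uniq_s /andP[pp prime_s]; rewrite mem_cat IHs //; apply/idP/idP.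
  case/orP=> [/andP[-> /allP n_s]|/mapP[k]].
    by apply/allP => q /n_s /= q_s; rewrite inE q_s orbT.
  rewrite IHs // => /andP[sqk /allP k_s] ->.
  have p_k : ~~ (p %| k)%N.
    apply: contra p_s => p_k; apply: k_s; rewrite mem_primes pp p_k squarefree_gt0 //.
  rewrite squarefree_mul_prime //=; apply/allP => q.
  rewrite (primesM _ (prime_gt0 pp) (squarefree_gt0 sqk)) primes_prime // inE /= inE.
  by case/orP=> [->//|/k_s /= q_s]; rewrite q_s orbT.
case/andP=> sq /allP n_s; have n_gt0 := squarefree_gt0 sq.
have [p_n|p_n] := boolP (p %| n)%N; last first.
  rewrite sq /=; apply/orP; left; apply/allP => q q_n; have := n_s q q_n.
  rewrite /= inE; case: eqP q_n => // -> ; by rewrite mem_primes (negPf p_n) !andbF.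
apply/orP; right; apply/mapP; exists (n %/ p)%N; last by rewrite mulnC divnK.
rewrite IHs // (squarefree_dvd sq (dvdn_div p_n)) /=; apply/allP => q.
rewrite mem_primes => /and3P[qq _ q_np]; have q_n := dvdn_trans q_np (dvdn_div p_n).
have := n_s q; rewrite mem_primes qq n_gt0 q_n /= inE => /(_ isT) /predU1P[qp|//].
have /andP[_ /allP/(_ p)] := sq; rewrite mem_primes pp n_gt0 p_n => /(_ isT)/negP; case.
by rewrite -(divnK p_n) expnS expn1 dvdn_pmul2r ?prime_gt0 // -{1}qp.
Qed.

Lemma subproducts_uniq s : uniq s -> all prime s -> uniq (subproducts s).
Proof.
elim: s => [|p s IHs] //= /andP[p_s uniq_s] /andP[pp prime_s].
rewrite cat_uniq IHs //= map_inj_uniq ?IHs // => [|i j /eqP]; last first.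
  by rewrite eqn_pmul2l ?prime_gt0 // => /eqP.
rewrite andbT; apply/hasPn => _ /mapP[k k_s ->]; apply/negP => /=.
have := k_s; rewrite !mem_subproducts // => /andP[sqk _] /andP[_ /allP/(_ p)].
rewrite mem_primes pp muln_gt0 prime_gt0 // squarefree_gt0 // dvdn_mulr //= => /(_ isT).
by rewrite (negPf p_s).
Qed.

Lemma prod_add_expand s (x e : nat -> R) : uniq s -> all prime s ->
  \prod_(p <- s) (e p + x p) =
  \sum_(n <- subproducts s) \prod_(p <- s) (if (p %| n)%N then x p else e p).
Proof.
elim: s => [|p s IHs] /=; first by rewrite big_nil big_seq1 big_nil.
case/andP=> p_s uniq_s /andP[pp prime_s]; rewrite big_cons IHs // big_cat big_map /= mulrDl.
rewrite !mulr_sumr big_seq [X in _ + X = _]big_seq [in RHS]big_seq [X in _ = _ + X]big_seq.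
have p_n n : n \in subproducts s -> ~~ (p %| n)%N.
  rewrite mem_subproducts // => /andP[sq /allP n_s]; apply: contra p_s => p_n.
  by apply: n_s; rewrite mem_primes pp p_n squarefree_gt0.
congr (_ + _); apply: eq_bigr => n /p_n pn; rewrite big_cons ?(negPf pn) // dvdn_mulr //.
congr (_ * _); rewrite big_seq [RHS]big_seq; apply: eq_bigr => q q_s.
have qq := allP prime_s _ q_s; rewrite Euclid_dvdM // (dvdn_prime2 qq pp).
by case: eqP q_s => // ->; rewrite (negPf p_s).
Qed.

Definition sqf_prod x n : R := if squarefree n then \prod_(p <- primes n) x p else 0.

(** The summand 1 is dropped from the factors at p | m, which kills every subproduct not divisible
    by m. The bound m < N ensures that all primes of m occur in the product. *)
Lemma prod_below_expand x m N : squarefree m -> (m < N)%N ->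
  \prod_(p <- primes_below N) ((~~ (p %| m)%N)%:R + x p) =
  \sum_(n <- subproducts (primes_below N)) sqf_prod x n *+ (m %| n)%N.
Proof.
move=> sqm mN; set s := primes_below N.
have uniq_s : uniq s := primes_below_uniq N; have prime_s : all prime s := primes_below_prime N.
rewrite (prod_add_expand _ (fun p => (~~ (p %| m)%N)%:R)) // big_seq [RHS]big_seq.
apply: eq_bigr => n; rewrite mem_subproducts // => /andP[sqn /allP n_s].
rewrite (bigID (fun p => p %| n)%N) /= /sqf_prod sqn -mulr_natr; congr (_ * _).
  rewrite (eq_bigr x) => [|p ->//]; rewrite -big_filter; apply: perm_big.
  apply: uniq_perm => [||p]; [exact: filter_uniq uniq_s|exact: primes_uniq|].
  rewrite mem_filter mem_primes squarefree_gt0 //=; apply/andP/andP => [[-> /(allP prime_s)->//]|[pp p_n]].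
  by split=> //; apply: n_s; rewrite mem_primes pp p_n squarefree_gt0.
have [m_n|m_n] := boolP (m %| n)%N.
  rewrite big1 // => p /negPf p_n; rewrite p_n; case: (boolP (p %| m)%N) => // p_m.
  by rewrite (dvdn_trans p_m m_n) in p_n.
have [p [pp p_m p_n]] : exists p, [/\ prime p, (p %| m)%N & ~~ (p %| n)%N].
  apply: contrapT => no_p; case/negP: m_n; apply/squarefree_dvdP => // p pp p_m.
  by apply: contrapT => /negP p_n; apply: no_p; exists p.
have p_s : p \in s.
  by rewrite mem_primes_below pp (leq_ltn_trans _ mN) // dvdn_leq // squarefree_gt0.
apply/eqP; rewrite prodf_seq_eq0; apply/hasP; exists p => //.
by rewrite p_n (negPf p_n) p_m eqxx.
Qed.

(** A squarefree n < N has all its primes below N, so the expanded product contains the whole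
    partial sum, and the rest consists of terms with n >= N. The bound [K] only serves to exceed all
    subproducts. *)
Lemma sum_subproducts_below (F : nat -> R) N : (0 < N)%N ->
    (forall n, ~~ squarefree n -> F n = 0) ->
  exists2 K, (N <= K)%N & \sum_(n <- subproducts (primes_below N)) F n =
    \sum_(1 <= n < N) F n + \sum_(N <= n < K | n \in subproducts (primes_below N)) F n.
Proof.
move=> N_gt0 F0; set s := primes_below N.
have uniq_s : uniq s := primes_below_uniq N; have prime_s : all prime s := primes_below_prime N.
pose K := (N + \max_(n <- subproducts s) n).+1.
have NK : (N <= K)%N by rewrite ltnW // ltnS leq_addr.
exists K => //; transitivity (\sum_(1 <= n < K | n \in subproducts s) F n).
  rewrite -[RHS]big_filter; apply: perm_big.
  apply: uniq_perm; rewrite ?filter_uniq ?iota_uniq ?subproducts_uniq // => n.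
  rewrite mem_filter mem_index_iota; case: (boolP (n \in _)) => //= n_s.
  have : squarefree n by move: n_s; rewrite mem_subproducts // => /andP[].
  move/squarefree_gt0 => ->; rewrite /K ltnS (leq_trans _ (leq_addl _ _)) //.
  exact: leq_bigmax_seq.
rewrite (@big_cat_nat _ _ _ N) //=; congr (_ + _).
rewrite big_mkcond big_nat [RHS]big_nat; apply: eq_bigr => n /andP[n_gt0 nN].
case: ifP => // n_s; have [sqn|/F0//] := boolP (squarefree n).
case/negP: n_s; rewrite mem_subproducts // sqn /=; apply/allP => p.
rewrite mem_primes /= mem_primes_below => /and3P[-> _ p_n] /=.
by rewrite (leq_ltn_trans _ nN) // dvdn_leq.
Qed.

Lemma normr_sqf_prod x n : `|sqf_prod x n| = sqf_prod (fun p => `|x p|) n.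
Proof. by rewrite /sqf_prod; case: ifP; rewrite ?normr0 // normr_prod. Qed.

Lemma sqf_prod_ge0 x n : (forall p, 0 <= x p) -> 0 <= sqf_prod x n.
Proof. by move=> x0; rewrite /sqf_prod; case: ifP => // _; apply: prodr_ge0. Qed.

(* The partial sums and the partial Euler products differ by at most a tail of
   the absolutely convergent series. *)
Lemma sqf_sum_cvg x m (C l : R) : squarefree m ->
    (forall N, \sum_(p <- primes_below N) `|x p| <= C) ->
    (fun N => \prod_(p <- primes_below N) ((~~ (p %| m)%N)%:R + x p)) @ \oo --> l ->
  (fun N => \sum_(1 <= n < N) sqf_prod x n *+ (m %| n)%N) @ \oo --> l.
Proof.
move=> sqm leC cvgP; pose y p := `|x p|.
pose V N := \sum_(1 <= n < N) sqf_prod y n.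
pose U N := \sum_(1 <= n < N) sqf_prod x n *+ (m %| n)%N.
pose P N := \prod_(p <- primes_below N) ((~~ (p %| m)%N)%:R + x p).
have y0 p : 0 <= y p by rewrite normr_ge0.
have v0 n : 0 <= sqf_prod y n by apply: sqf_prod_ge0.
have ndV : nondecreasing_seq V.
  apply/nondecreasing_seqP => N; rewrite /V; case: N => [|N]; first by rewrite !big_geq.
  by rewrite [leRHS]big_nat_recr //= lerDl.
(* Uses prod (1 + |x_p|) <= exp (sum |x_p|). The shift to N + 2 secures the bound 1 < N required by
   the expansion at m = 1. *)
have V_le N : V N <= expR C.
  apply: (le_trans (ndV N N.+2 (leqW (leqnSn N)))).
  have [n nsq|K NK E] := sum_subproducts_below (F := sqf_prod y) (ltn0Sn N.+1).
    by rewrite /sqf_prod (negPf nsq).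
  apply: (@le_trans _ _ (\prod_(p <- primes_below N.+2) (1 + y p))).
    have := @prod_below_expand y 1 N.+2 isT isT.
    rewrite [X in X = _](eq_big_seq (fun p => 1 + y p)) => [->|p]; last first.
      by rewrite mem_primes_below => /andP[pp _]; rewrite dvdn1 gtn_eqF ?prime_gt1.
    rewrite (eq_bigr (sqf_prod y)) => [|n _]; last by rewrite dvd1n.
    by rewrite E lerDl sumr_ge0.
  apply: (@le_trans _ _ (\prod_(p <- primes_below N.+2) expR (y p))).
    by apply: ler_prod => p _; rewrite addr_ge0 ?expR_ge1Dx.
  by rewrite -expR_sum ler_expR.
have cvgV : cvgn V.
  by apply: nondecreasing_is_cvgn => //; exists (expR C) => _ [N _ <-].
pose T := limn V.
have V_le_T N : V N <= T by apply: nondecreasing_cvgn_le.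
have dist N : (m < N)%N -> `|P N - U N| <= T - V N.
  move=> mN; have N_gt0 : (0 < N)%N by apply: leq_ltn_trans mN.
  rewrite /P prod_below_expand //.
  have [n nsq|K NK ->] := sum_subproducts_below (F := fun n => sqf_prod x n *+ (m %| n)%N) N_gt0.
    by rewrite /sqf_prod (negPf nsq) mul0rn.
  rewrite -/(U N) [U N + _]addrC addrK; apply: le_trans (ler_norm_sum _ _ _) _.
  apply: (@le_trans _ _ (\sum_(N <= n < K) sqf_prod y n)).
    rewrite big_mkcond; apply: ler_sum => n _; case: ifP => // _.
    by case: (m %| n)%N; rewrite ?mulr1n ?normr_sqf_prod // mulr0n normr0.
  rewrite lerBrDl; apply: le_trans (V_le_T K).
  by rewrite /V [leRHS](@big_cat_nat _ _ _ N).
have cvg_lo : (fun N => P N - (T - V N)) @ \oo --> l.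
  rewrite -[l]subr0 -(subrr T); apply: cvgB => //; apply: cvgB => //; exact: cvg_cst.
have cvg_hi : (fun N => P N + (T - V N)) @ \oo --> l.
  rewrite -[l]addr0 -(subrr T); apply: cvgD => //; apply: cvgB => //; exact: cvg_cst.
apply: squeeze_cvgr cvg_lo cvg_hi.
exists m.+1 => // N /= mN; have := dist N mN; rewrite ler_norml => /andP[lo hi].
rewrite -/(U N); lra.
Qed.

End SquarefreeSums.

(** * The terms of the series and its sum *)

Section Kummer.
Variables (g : rat) (h : nat) (g1 : int) (g2 : rat) (f a : nat).
Hypotheses (g_neq0 : g != 0) (g_nonsquare : ~ exists r : rat, g = r ^+ 2).
Hypotheses (h_gt0 : (0 < h)%N) (g_hpower : exists r : rat, g = r ^+ h).
Hypothesis (h_largest : forall k : nat, (0 < k)%N -> (exists r : rat, g = r ^+ k) -> (k <= h)%N).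
Hypotheses (g1_sqf : squarefree `|g1|%N) (gE : g = g1%:~R * g2 ^+ 2).
Hypotheses (f_gt0 : (0 < f)%N) (af : coprime a f).

(** If p did not divide h, Bezout x p - y h = 1 would combine a p-th root s and an h-th root t of g
    into a ph-th root t^x / s^y, against the maximality of h. *)
Lemma power_dvd_index p : prime p -> (exists s : rat, g = s ^+ p) -> (p %| h)%N.
Proof.
move=> pp [s gs]; have [t gt] := g_hpower; have p_gt0 := prime_gt0 pp.
apply: contraT => p_h; have co : coprime p h by rewrite prime_coprime.
case: (egcdnP h p_gt0) => x y; rewrite (eqP co) => xy _.
have := h_largest (k := (p * h)%N); rewrite muln_gt0 p_gt0 h_gt0 => /(_ isT).
have H : exists r : rat, g = r ^+ (p * h).
  exists (t ^+ x / s ^+ y).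
  have s_neq0 : s != 0 by apply: contraNneq g_neq0 => s0; rewrite gs s0 expr0n gtn_eqF.
  rewrite expr_div_n -!exprM; apply: (canRL (mulfK _)); first by rewrite expf_neq0.
  have -> : t ^+ (x * (p * h)) = g ^+ (x * p) by rewrite gt -exprM; congr (_ ^+ _); lia.
  have -> : s ^+ (y * (p * h)) = g ^+ (y * h) by rewrite gs -exprM; congr (_ ^+ _); lia.
  by rewrite -exprS -addn1 xy.
by move=> /(_ H); rewrite leqNgt ltn_Pmull ?prime_gt1.
Qed.

Lemma index_odd : odd h.
Proof.
apply: contraT => h_even; case: g_nonsquare; have [t gt] := g_hpower.
exists (t ^+ h./2); rewrite -exprM gt; congr (_ ^+ _).
by have := odd_double_half h; rewrite (negPf h_even) muln2.
Qed.

Lemma g2_neq0 : g2 != 0.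
Proof. by apply: contraNneq g_neq0 => g20; rewrite gE g20 expr0n mulr0. Qed.

Lemma sqrt_g_sqrt_g1 (x : algC) : x ^+ 2 = ratr g -> (x / ratr g2) ^+ 2 = g1%:~R.
Proof.
move=> x2; rewrite expr_div_n x2 gE rmorphM rmorphXn /= mulfK ?ratr_int //.
by rewrite expf_neq0 // fmorph_eq0 g2_neq0.
Qed.

Lemma sqrt_g_in_cyclotomic N (x : algC) : (0 < N)%N -> x ^+ 2 = ratr g ->
  in_cyclotomic N x <-> disc_dvd g1 N.
Proof.
move=> N_gt0 x2; have y2 := sqrt_g_sqrt_g1 x2.
have g2C : ratr g2 != 0 :> algC by rewrite fmorph_eq0 g2_neq0.
split=> [cyc_x|disc].
  apply: contraT => ndisc; case: (sqrt_notin_cyclotomic g1_sqf N_gt0 ndisc y2).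
  by rewrite -fmorphV; apply: in_cyclotomicM => //; apply: in_cyclotomic_rat.
have [S [S2 cyc_S _]] := sqchar_squarefree g1_sqf N_gt0 disc.
rewrite -[x](mulfVK g2C); apply: in_cyclotomicM; last exact: in_cyclotomic_rat.
have /eqP : (x / ratr g2) ^+ 2 = S ^+ 2 by rewrite y2 S2.
rewrite eqf_sqr => /orP[] /eqP -> //.
by rewrite -sub0r; apply: in_cyclotomicB => //; rewrite -(rmorph0 QtoC); apply: in_cyclotomic_rat.
Qed.

Lemma root_of_power p (x : algC) : (0 < p)%N -> (p %| h)%N -> x ^+ p = ratr g ->
  exists (s : rat) w, w ^+ p = 1 /\ x = ratr s * w.
Proof.
move=> p_gt0 /dvdnP[k hE] xp; have [t gt] := g_hpower.
have gs : g = (t ^+ k) ^+ p by rewrite gt hE exprM.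
have s_neq0 : ratr (t ^+ k) != 0 :> algC.
  by rewrite fmorph_eq0; apply: contraNneq g_neq0 => s0; rewrite gs s0 expr0n gtn_eqF.
exists (t ^+ k), (x / ratr (t ^+ k)); split; last by rewrite mulrC mulfVK.
by rewrite expr_div_n xp gs rmorphXn divff // expf_neq0.
Qed.

(** * Degree and value of c_a at a squarefree level n *)

Section Level.
Variable n : nat.
Hypothesis n_sqf : squarefree n.
Let n_gt0 : (0 < n)%N. Proof. exact: squarefree_gt0. Qed.
Local Notation N := (lcmn f n).
Let N_gt0 : (0 < N)%N. Proof. by rewrite lcmn_gt0 f_gt0. Qed.
Let n_N : (n %| N)%N. Proof. exact: dvdn_lcmr. Qed.
Let f_N : (f %| N)%N. Proof. exact: dvdn_lcml. Qed.
Local Notation rho := (n.-root (ratr g) : algC).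
Let rhon : rho ^+ n = ratr g. Proof. by rewrite rootCK. Qed.

(** The entangled case: a square root of g, present in Q(zeta_n, g^(1/n)) because n is even, already
    lies in Q(zeta_N). *)
Definition ramified := (2 %| n)%N && disc_dvd g1 N.

Lemma root_in_cyclotomic p : prime p -> (p %| n)%N ->
  in_cyclotomic N (rho ^+ (n %/ p)) <-> (p %| h)%N || ((p == 2%N) && ramified).
Proof.
move=> pp p_n; set x := rho ^+ _.
have xp : x ^+ p = ratr g by rewrite -exprM divnK.
have p_gt0 := prime_gt0 pp.
have [p_h|p_h] /= := boolP (p %| h)%N.
  split=> // _; have [s [w [wp ->]]] := root_of_power p_gt0 p_h xp.
  apply: in_cyclotomicM; first exact: in_cyclotomic_rat.
  apply: (in_cyclotomicS N_gt0 n_N); apply: in_cyclotomic_root => //.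
  by rewrite -(divnK p_n) mulnC exprM wp expr1n.
have [p2|p2] /= := eqVneq p 2%N.
  by rewrite /ramified -p2 p_n /=; apply: sqrt_g_in_cyclotomic => //; rewrite -p2.
split=> // cyc_x; case/negP: p_h; apply: power_dvd_index => //.
apply: (odd_root_in_cyclotomic _ N_gt0 (dvdn_trans p_n n_N) xp cyc_x).
by case: (even_prime pp) p2 => // ->.
Qed.

Local Notation gens := (zeta f :: kummer_gens n g).

Lemma kummer_field : exists z r : adj gens,
  [/\ adj_inj _ z = zeta N, adj_inj _ r = rho & <<<<1; z>>; r>>%VS = fullv].
Proof.
have [zf zfE] : exists y, adj_inj gens y = zeta f by apply: adj_mem; rewrite mem_head.
have [zn znE] : exists y, adj_inj gens y = zeta n by apply: adj_mem; rewrite !inE eqxx orbT.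
have [r rE] : exists y, adj_inj gens y = rho by apply: adj_mem; rewrite !inE eqxx !orbT.
have [i [j zE]] := zeta_lcm f_gt0 n_gt0.
have izE : adj_inj gens (zf ^+ i * zn ^+ j) = zeta N by rewrite rmorphM !rmorphXn /= zfE znE zE.
exists (zf ^+ i * zn ^+ j), r; split=> //; set z := _ * _ in izE *.
apply/eqP; rewrite eqEsubv subvf /= -(adj_gens_full gens).
apply/(@Fadjoin_seqP _ _ 1%AS _ <<<<1; z>>; r>>%AS); split; first exact: sub1v.
have mem_z x M : (M %| N)%N -> (0 < M)%N -> adj_inj gens x = zeta M -> x \in <<<<1; z>>; r>>%VS.
  move=> M_N M_gt0 xE; apply: (subvP (subv_adjoin _ _)).
  apply/(mem_cyclotomicP izE); rewrite xE; apply: (in_cyclotomicS N_gt0 M_N).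
  by apply: in_cyclotomic_root; rewrite ?zeta_exp.
move=> x /(map_f (adj_inj gens)); rewrite adj_gensE !inE => /or3P[] /eqP xE.
- exact: mem_z xE.
- exact: mem_z xE.
by have -> : x = r; [apply: (fmorph_inj (adj_inj gens)); rewrite xE rE | apply: memv_adjoin].
Qed.

(** The primes of n missing from the degree of [rho] over Q(zeta_N) are those dividing h, and 2 in
    the [ramified] case; as h is odd, these do not overlap. Division is avoided by moving them to
    the left. *)
Lemma adj_deg_kummer :
  (adj_deg gens * \prod_(p <- primes n | p %| h) p * (if ramified then 2 else 1)
   = totient N * n)%N.
Proof.
have [z [r [zE rE gen]]] := kummer_field.
have r_neq0 : r != 0.
  rewrite -(fmorph_eq0 (adj_inj gens)) rE; apply: contraNneq g_neq0 => r0.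
  by move/eqP: rhon; rewrite r0 expr0n gtn_eqF //= eq_sym fmorph_eq0.
have rn : r ^+ n \in 1%VS.
  apply/vlineP; exists g; apply: (fmorph_inj (adj_inj gens)).
  by rewrite rmorphXn /= rE rhon alg_num_field fmorph_rat.
rewrite /adj_deg (dim_pure N_gt0 zE gen).
rewrite (pure_degreeE N_gt0 n_sqf n_N zE r_neq0 rn).
have mem_E p : p \in primes n ->
    (r ^+ (n %/ p) \in <<1; z>>%VS) = (p %| h)%N || ((p == 2%N) && ramified).
  rewrite mem_primes n_gt0 => /and3P[pp _ p_n].
  apply/(mem_cyclotomicP zE)/idP; rewrite rmorphXn rE => /root_in_cyclotomic; exact.
suff key : (\prod_(p <- primes n | p %| h) p * (if ramified then 2 else 1)
    = \prod_(p <- primes n | ~~ (r ^+ (n %/ p) \notin <<1; z>>%VS)) p)%N.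
  rewrite -mulnA key -[X in _ = (_ * X)%N](squarefree_prod n_sqf).
  rewrite [X in _ = (_ * X)%N](bigID (fun p => r ^+ (n %/ p) \notin <<1; z>>%VS)) /=.
  by rewrite [RHS]mulnCA mulnA.
rewrite big_seq_cond [RHS]big_seq_cond.
rewrite [RHS](eq_bigl (fun p => (p \in primes n) && ((p %| h)%N || ((p == 2%N) && ramified)))); last first.
  by move=> p; have [p_n|] //= := boolP (p \in primes n); rewrite negbK mem_E.
rewrite -!big_seq_cond.
case: (boolP ramified) => ram; last by rewrite muln1; apply: eq_bigl => p; rewrite andbF orbF.
rewrite [RHS](bigID (fun p => p %| h)%N) /=; congr (_ * _)%N.
  by apply: eq_bigl => p; rewrite andbT andbC; case: (p %| h)%N.
transitivity (\prod_(p <- primes n | ~~ odd p) p)%N; last first.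
  rewrite big_seq_cond [RHS]big_seq_cond; apply: eq_bigl => p.
  rewrite mem_primes; have [pp|] //= := boolP (prime p).
  case: (even_prime pp) => [->|p_odd]; first by rewrite [(2 %| h)%N]dvdn2 index_odd /= !andbT.
  rewrite p_odd andbT; case: eqP p_odd => [->//|_ _].
  by rewrite orbF andbN !andbF.
by rewrite big_primes_even mem_primes n_gt0; have /andP[-> _] := ram.
Qed.

(** The sign kappa. It is the quadratic character of the factor c = +-(g1, f) of g1 whose cofactor
    is 1 mod 4; hence the odd parts of c and g1 agree mod 4 and that of g1 may be used. *)
Definition frob_sign : int :=
  (if (odd_part g1 == 1 %[mod 4])%Z then 1 else sign_char a) * jacobi a (gcdn `|g1| f).

Local Notation d0 := (gcdn `|g1| f).
Local Notation b := (`|g1| %/ d0)%N.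

Lemma beta_coprime_f p : prime p -> (p %| b)%N -> ~~ (p %| f)%N.
Proof.
move=> pp p_b; apply/negP => p_f.
have absE : `|g1|%N = (b * d0)%N by rewrite divnK // dvdn_gcdl.
have p_g1 : (p %| `|g1|)%N by rewrite absE dvdn_mulr.
have p_d0 : (p %| d0)%N by rewrite dvdn_gcd p_g1.
have /andP[g1_gt0 /allP/(_ p)] := g1_sqf; rewrite mem_primes pp g1_gt0 p_g1 => /(_ isT)/negP; case.
by rewrite absE (dvdn_mul p_b p_d0).
Qed.

(** An even beta would make g1 even, so that 8 | f, but no prime of beta divides f. *)
Lemma beta_odd : disc_cond g1 f -> odd b.
Proof.
move=> f_cond; rewrite -[odd b]negbK -dvdn2; apply/negP => b2.
case/negP: (beta_coprime_f (isT : prime 2) b2).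
have : (2 %| `|g1|)%N by apply: dvdn_trans b2 _; apply: dvdn_div; apply: dvdn_gcdl.
by move: f_cond; rewrite /disc_cond; clear; lia.
Qed.

(** As n is squarefree, 4 or 8 divides lcm(f, n) only if it divides f, which moves the condition at
    2 from N to f. The primes of beta do not divide f, so they must divide n. *)
Lemma ramifiedE : ramified = disc_cond g1 f && (2 * b %| n)%N.
Proof.
have absE : `|g1|%N = (b * d0)%N by rewrite divnK // dvdn_gcdl.
apply/idP/andP => [/andP[n2 /andP[g1_N cond]]|[cond b2_n]]; last first.
  rewrite /ramified (dvdn_trans _ b2_n) ?dvdn_mulr //=; apply/andP; split; last first.
    move: cond; rewrite /disc_cond => /or3P[->//|/andP[-> f8]|/andP[-> f4]].
      by rewrite (dvdn_trans f8) ?orbT.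
    by rewrite (dvdn_trans f4) ?orbT.
  apply/squarefree_dvdP => // p pp; rewrite absE Euclid_dvdM // => /orP[p_b|p_d0].
    by apply: dvdn_trans (dvdn_lcmr f n); apply: dvdn_trans b2_n; apply: dvdn_mull.
  by apply: dvdn_trans (dvdn_lcml f n); apply: dvdn_trans p_d0 (dvdn_gcdr _ _).
have n4 : ~~ (4 %| n)%N.
  by have /andP[_ /allP/(_ 2%N)] := n_sqf; rewrite mem_primes n_gt0 n2; apply.
have N_pow k : (1 < k)%N -> (2 ^ k %| N)%N -> (2 ^ k %| f)%N.
  move=> k1; rewrite !pfactor_dvdn // logn_lcm // leq_max => /orP[//|].
  have : (logn 2 n < 2)%N by rewrite ltnNge -pfactor_dvdn.
  by move=> l2 /leq_ltn_trans/(_ l2); rewrite ltnNge k1.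
have f_cond : disc_cond g1 f.
  rewrite /disc_cond.
  by case/or3P: cond => [->//|/andP[-> /(N_pow 3%N isT)->]|/andP[-> /(N_pow 2%N isT)->]]; rewrite ?orbT.
split=> //; rewrite Gauss_dvd ?coprime2n ?beta_odd // n2 /=.
apply/(squarefree_dvdP _ (squarefree_dvd g1_sqf (dvdn_div (dvdn_gcdl _ _)))).
move=> p pp p_b; have : (p %| N)%N by apply: dvdn_trans g1_N; rewrite absE dvdn_mulr.
move=> p_N; have : (p %| f * n)%N by rewrite -muln_lcm_gcd dvdn_mulr.
by rewrite Euclid_dvdM // (negPf (beta_coprime_f pp p_b)).
Qed.

(* Under [ramified], [sqrt g1] is the product of a square root of an integer
   of absolute value [(g1, f)], lying in [Q(zeta_f)], and of an element of
   [Q(zeta_n)]. *)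
Lemma ramified_sqrt : ramified -> exists S T : algC,
  [/\ in_cyclotomic f S, in_cyclotomic n T, (S * T) ^+ 2 = g1%:~R &
      forall tau, acts_as f tau a -> tau S = frob_sign%:~R * S].
Proof.
rewrite ramifiedE => /andP[f_cond b2_n].
have g1_gt0 := squarefree_gt0 g1_sqf.
have d0_g1 : (d0 %| `|g1|)%N := dvdn_gcdl _ _.
have d0_f : (d0 %| f)%N := dvdn_gcdr _ _.
have absE : `|g1|%N = (b * d0)%N by rewrite divnK.
have b_odd := beta_odd f_cond.
have b_n : (b %| n)%N by apply: dvdn_trans b2_n; apply: dvdn_mull.
(* The sign makes [bs] 1 mod 4, so that its square root lies in Q(zeta_n) although 4 does not divide
   n; the cofactor [c] is then g1 mod 4 and inherits the condition at f. *)
pose bs : int := if (b %% 4 == 1)%N then b%:Z else - b%:Z.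
have bs4 : (bs = 1 %[mod 4])%Z by rewrite /bs; move: b_odd; clear; case: ifP; lia.

have abs_bs : `|bs|%N = b by rewrite /bs; case: ifP; rewrite ?abszN.
have bs_neq0 : bs != 0 by rewrite -absz_gt0 abs_bs odd_gt0.
pose c : int := if g1 == d0%:Z * bs then d0%:Z else - d0%:Z.
have abs_c : `|c|%N = d0 by rewrite /c; case: ifP; rewrite ?abszN.
have g1E : g1 = c * bs.
  have : `|g1|%N = `|(d0%:Z * bs)%R|%N by rewrite abszM abs_bs mulnC -absE.
  rewrite /c; case: eqP => // g1_neq; rewrite mulNr; move: (d0%:Z * bs) g1_neq; clear; lia.
have disc_b : disc_dvd bs n by rewrite /disc_dvd /disc_cond abs_bs b_n; move: bs4 => /eqP ->.
have c_sqf : squarefree `|c| by rewrite abs_c; apply: squarefree_dvd g1_sqf _.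
have b_sqf : squarefree `|bs| by rewrite abs_bs; apply: squarefree_dvd g1_sqf (dvdn_div d0_g1).
have c4 : (c = g1 %[mod 4])%Z.
  by rewrite g1E -modzMmr bs4 modzMmr mulr1.
have disc_c : disc_dvd c f.
  by rewrite /disc_dvd abs_c d0_f /disc_cond c4.
have [S [S2 cyc_S tS]] := sqchar_squarefree c_sqf f_gt0 disc_c.
have [T [T2 cyc_T _]] := sqchar_squarefree b_sqf n_gt0 disc_b.
exists S, T; split=> //; first by rewrite exprMn S2 T2 -intrM -g1E.
move=> tau tP; rewrite (tS _ _ af tP) /quad_char abs_c /frob_sign.
suff -> : (odd_part c == 1 %[mod 4])%Z = (odd_part g1 == 1 %[mod 4])%Z by [].
have [cE c_odd] := squarefree_odd_part c_sqf; have [gE' g_odd] := squarefree_odd_part g1_sqf.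
have o_eq : odd_part g1 = odd_part c * bs.
  have : (2 %| `|g1|)%N = (2 %| `|c|)%N.
    by rewrite abs_c [in LHS]absE Euclid_dvdM // dvdn2 b_odd.
  move=> e; move: gE'; rewrite {1}g1E {1}cE e; case: ifP => _; last by rewrite !mulr1.
  by rewrite -mulrA [2 * bs]mulrC mulrA => /mulIf ->.
by rewrite o_eq -modzMmr bs4 modzMmr mulr1.
Qed.

Lemma sqrt_g_act x : ramified -> x ^+ 2 = ratr g ->
  forall tau, acts_as f tau a -> acts_as n tau 1 -> tau x = frob_sign%:~R * x.
Proof.
move=> ram x2 tau tf tn; have [S [T [_ cyc_T ST2 tS]]] := ramified_sqrt ram.
have g2C : ratr g2 != 0 :> algC by rewrite fmorph_eq0 g2_neq0.
have tST : tau (S * T) = frob_sign%:~R * (S * T).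
  by rewrite rmorphM /= (tS _ tf) (acts_as_id tn cyc_T) mulrA.
have xE : x = ratr g2 * (x / ratr g2) by rewrite mulrC mulfVK.
have y2 := sqrt_g_sqrt_g1 x2; move: (x / ratr g2) y2 xE => y y2 ->.
rewrite [tau _]rmorphM /= fmorph_rat mulrCA; congr (_ * _).
have /eqP : y ^+ 2 = (S * T) ^+ 2 by rewrite ST2.
by rewrite eqf_sqr => /orP[] /eqP -> //; rewrite [tau _]rmorphN /= tST mulrN.
Qed.

Lemma squarefree_gcd_coprime :
  coprime f (n %/ gcdn f n) /\ coprime (gcdn f n) (n %/ gcdn f n).
Proof.
pose d := gcdn f n; pose n' := (n %/ d)%N.
have nE : n = (n' * d)%N by rewrite divnK // dvdn_gcdr.
have co_sqf p : prime p -> (p %| n')%N -> (p %| d)%N -> False.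
  move=> pp p_n' p_d; have p_n : (p %| n)%N by rewrite nE dvdn_mulr.
  have /andP[_ /allP/(_ p)] := n_sqf; rewrite mem_primes pp n_gt0 p_n => /(_ isT)/negP; apply.
  by rewrite nE (dvdn_mul p_n' p_d).
have co_of m : (forall p, prime p -> (p %| n')%N -> (p %| m)%N -> False) -> coprime m n'.
  move=> H; rewrite coprime_sym /coprime; apply/eqP.
  have g_gt0 : (0 < gcdn n' m)%N by rewrite gcdn_gt0 divn_gt0 ?gcdn_gt0 ?f_gt0 // dvdn_leq ?dvdn_gcdr.
  apply/eqP; rewrite eqn_leq g_gt0 andbT leqNgt; apply/negP => /pdiv_prime pp.
  by case: (H _ pp (dvdn_trans (pdiv_dvd _) (dvdn_gcdl _ _)) (dvdn_trans (pdiv_dvd _) (dvdn_gcdr _ _))).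
split; apply: co_of => p pp p_n' p_m; apply: (co_sqf p pp p_n') => //.
by rewrite dvdn_gcd p_m nE dvdn_mulr.
Qed.

Lemma totient_lcm_gcd : (totient N * totient (gcdn f n) = totient f * totient n)%N.
Proof.
have [co_f co_d] := squarefree_gcd_coprime.
have nE : n = (gcdn f n * (n %/ gcdn f n))%N by rewrite mulnC divnK // dvdn_gcdr.
have NE : N = (f * (n %/ gcdn f n))%N by rewrite /lcmn muln_divA ?dvdn_gcdr.
by rewrite NE {4}nE !totient_coprime // -!mulnA [(totient (n %/ _) * _)%N]mulnC.
Qed.

(** Since n/(f, n) is coprime to f and to (f, n), the residues a mod f and 1 mod n/(f, n) can be
    prescribed; the hypothesis supplies the congruence modulo (f, n). *)
Lemma crt_lift : (a = 1 %[mod gcdn f n])%N ->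
  exists u, [/\ coprime u N, (u = a %[mod f])%N & (u = 1 %[mod n])%N].
Proof.
move=> a1; pose n' := (n %/ gcdn f n)%N.
have [co_f co_d] := squarefree_gcd_coprime.
pose u := chinese f n' a 1.
have uf : (u = a %[mod f])%N by apply: chinese_modl.
have un' : (u = 1 %[mod n'])%N by apply: chinese_modr.
have un : (u = 1 %[mod n])%N.
  apply/eqP; have := chinese_remainder co_d u 1.
  rewrite [(gcdn f n * _)%N]mulnC divnK ?dvdn_gcdr // -/n' un' eqxx andbT => ->.
  by rewrite -(modn_dvdm u (dvdn_gcdl f n)) uf (modn_dvdm _ (dvdn_gcdl f n)) a1.
exists u; split=> //.
apply: (@coprime_dvdr _ (f * n)); first by rewrite -muln_lcm_gcd dvdn_mulr.
rewrite coprimeMr; apply/andP; split; first by rewrite /coprime -gcdn_modl uf gcdn_modl.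
by rewrite /coprime -gcdn_modl un gcdn_modl gcd1n.
Qed.

(** An automorphism extending sigma_a and trivial on the whole of Q(zeta_n, g^(1/n)). After lifting
    the residue class, it remains to see that rho^d, with d the degree over Q(zeta_N), is fixed. *)
Lemma frob_lift : (a = 1 %[mod gcdn f n])%N -> (ramified -> frob_sign = 1) ->
  exists tau, [/\ acts_as f tau a, acts_as n tau 1 & tau rho = rho].
Proof.
move=> /crt_lift[u [co_u uf un]] sign1.
have [tau0 t0P] := Qn_aut_exists co_u.
have actf tau : acts_as N tau u -> acts_as f tau a.
  move=> tP w wf; rewrite (acts_asS f_N tP) // -(expr_mod _ wf) uf (expr_mod _ wf) //.
have actn tau : acts_as N tau u -> acts_as n tau 1.
  by move=> tP w wn; rewrite (acts_asS n_N tP) // -(expr_mod _ wn) un (expr_mod _ wn).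
have [z [r [zE rE gen]]] := kummer_field.
have rho_neq0 : rho != 0.
  apply: contraNneq g_neq0 => r0.
  by move/eqP: rhon; rewrite r0 expr0n gtn_eqF //= eq_sym fmorph_eq0.
have r_neq0 : r != 0 by rewrite -(fmorph_eq0 (adj_inj gens)) rE.
have rn : r ^+ n \in 1%VS.
  apply/vlineP; exists g; apply: (fmorph_inj (adj_inj gens)).
  by rewrite rmorphXn /= rE rhon alg_num_field fmorph_rat.
pose d := adjoin_degree <<1; z>>%AS r.
have d_n : (d %| n)%N by apply: (pure_degree_dvdn N_gt0 n_sqf n_N zE r_neq0 rn).
have fix_p p : prime p -> (p %| n)%N -> ~~ (p %| d)%N ->
    tau0 (rho ^+ (n %/ p)) = rho ^+ (n %/ p).
  move=> pp p_n; rewrite (prime_dvd_pure_degree N_gt0 n_sqf n_N zE r_neq0 rn) // negbK.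
  move=> /(mem_cyclotomicP zE); rewrite rmorphXn /= rE => /(root_in_cyclotomic pp p_n).
  have xp : (rho ^+ (n %/ p)) ^+ p = ratr g by rewrite -exprM divnK.
  move=> /orP[p_h|/andP[/eqP p2 ram]].
    have [s [w [wp ->]]] := root_of_power (prime_gt0 pp) p_h xp.
    rewrite rmorphM /= fmorph_rat (actn _ t0P) //.
    by rewrite -(divnK p_n) mulnC exprM wp expr1n.
  rewrite (@sqrt_g_act _ ram _ tau0 (actf _ t0P) (actn _ t0P)) ?sign1 ?mul1r //.
  by rewrite -p2.
have fix_d : tau0 (rho ^+ d) = rho ^+ d.
  (* The quotient [w] is an e-th root of unity. A prime p of its order m does not divide d, so
     rho^(n/p) is in Q(zeta_N) and fixed, whence w^(e/p) = 1; then p | m | e/p contradicts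
     squarefreeness. *)
  pose e := (n %/ d)%N; pose w := tau0 (rho ^+ d) / rho ^+ d.
  have d_gt0 : (0 < d)%N by [].
  have nE : n = (d * e)%N by rewrite mulnC divnK.
  have we k : tau0 ((rho ^+ d) ^+ k) = (rho ^+ d) ^+ k -> w ^+ k = 1.
    by move=> H; rewrite /w expr_div_n -rmorphXn H divff // !expf_neq0.
  have w_e : w ^+ e = 1 by apply: we; rewrite -exprM -nE rhon fmorph_rat.
  have e_gt0 : (0 < e)%N by rewrite divn_gt0 // dvdn_leq.
  have [m mP m_e] := prim_order_exists e_gt0 w_e.
  suff m1 : m = 1%N.
    have := prim_expr_order mP; rewrite m1 expr1 => w1.
    by rewrite -[LHS](mulfVK (expf_neq0 d rho_neq0)) -/w w1 mul1r.
  have m_gt0 := prim_order_gt0 mP.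
  apply/eqP; rewrite eqn_leq m_gt0 andbT leqNgt; apply/negP => /pdiv_prime pp.
  set p := pdiv m in pp; have p_m : (p %| m)%N := pdiv_dvd _.
  have p_e := dvdn_trans p_m m_e.
  have pn : (p * p %| n)%N = false.
    have p_n : (p %| n)%N by rewrite nE dvdn_mull.
    by have /andP[_ /allP/(_ p)] := n_sqf; rewrite mem_primes pp n_gt0 p_n => /(_ isT)/negbTE.
  have p_d : ~~ (p %| d)%N by apply/negP => p_d; rewrite nE (dvdn_mul p_d p_e) in pn.
  have : w ^+ (e %/ p) = 1.
    apply: we; rewrite -exprM muln_divA // -nE; apply: fix_p => //.
    by rewrite nE dvdn_mull.
  move/eqP; rewrite -(prim_order_dvd mP) => /(dvdn_trans p_m).
  by rewrite dvdn_divRL // => pp_e; rewrite nE dvdn_mull in pn.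
have [] := extend_fixing_root N_gt0 n_sqf n_N zE r_neq0 rn gen t0P _.
  by rewrite -/d rmorphXn /= rE.
by move=> tau tP; rewrite rE => tr; exists tau; split; [apply: actf|apply: actn|].
Qed.

(** Necessity is tested on two elements of the intersection: a primitive (f, n)-th root of unity,
    and in the [ramified] case the factor S of sqrt g1, which is sqrt g1 divided by an element of
    Q(zeta_n). Sufficiency restricts the automorphism of [frob_lift]. *)
Lemma c_aE : c_a af g n =
  (a == 1 %[mod gcdn f n])%N && (ramified ==> (frob_sign == 1)).
Proof.
apply/asboolP/andP => [fixP|[/eqP a1 /implyP sign1]]; last first.
  move=> x [y yx]; have [tau [tf tn tr]] := frob_lift a1 (fun ram => eqP (sign1 ram)).
  apply: (fmorph_inj (adj_inj _)); rewrite (adj_inj_sigma _ _ tf) -yx fix_adj //.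
  move=> t; rewrite !inE => /orP[] /eqP -> //.
  by rewrite tn ?zeta_exp.
have fix_cyc x : in_cyclotomic f x -> (exists y : adj (kummer_gens n g), adj_inj _ y = x) ->
    forall tau, acts_as f tau a -> tau x = x.
  move=> /(@in_cyclotomic_adj [:: zeta f])[|x' <-]; first by rewrite mem_head.
  by move=> /fixP x'_fix tau tf; rewrite -(adj_inj_sigma _ _ tf) x'_fix.
have [tau tf] := Qn_aut_exists af.
have kum_zeta x : in_cyclotomic n x -> exists y : adj (kummer_gens n g), adj_inj _ y = x.
  by apply: in_cyclotomic_adj; rewrite mem_head.
split.
  pose d0 := gcdn f n; have d0_f : (d0 %| f)%N := dvdn_gcdl _ _.
  have zP := dvdn_prim_root (zeta_prim f_gt0) d0_f.
  set z := zeta f ^+ (f %/ d0) in zP.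
  have zf : z ^+ f = 1 by rewrite -(divnK d0_f) mulnC exprM (prim_expr_order zP) expr1n.
  have zn : z ^+ n = 1.
    by rewrite -(divnK (dvdn_gcdr f n)) mulnC exprM (prim_expr_order zP) expr1n.
  rewrite -(eq_prim_root_expr zP) expr1 -(tf _ zf); apply/eqP.
  apply: fix_cyc tf; first exact: in_cyclotomic_root.
  by apply/kum_zeta/in_cyclotomic_root.
apply/implyP => ram; have [S [T [cyc_S cyc_T ST2 tS]]] := ramified_sqrt ram.
have g1C : g1%:~R != 0 :> algC.
  by rewrite intr_eq0 -absz_gt0 squarefree_gt0.
have ST0 : S * T != 0 by apply: contra_eq_neq ST2 => ->; rewrite expr0n eq_sym.
have [S0 T0] : S != 0 /\ T != 0 by apply/andP; rewrite -negb_or -mulf_eq0.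
have : tau S = S.
  apply: fix_cyc tf => //.
  have /andP[n2 _] := ram; pose x := rho ^+ (n %/ 2).
  have x2 : x ^+ 2 = ratr g by rewrite -exprM divnK.
  have [y yE] : exists y : adj (kummer_gens n g), adj_inj _ y = rho.
    by apply: adj_mem; rewrite !inE eqxx orbT.
  have [t tE] := kum_zeta _ cyc_T.
  have /eqP : (x / ratr g2) ^+ 2 = (S * T) ^+ 2 by rewrite ST2 sqrt_g_sqrt_g1.
  have rE : adj_inj (kummer_gens n g) (y ^+ (n %/ 2) / ratr g2 / t) = x / ratr g2 / T.
    by rewrite 2!fmorph_div rmorphXn /= yE tE fmorph_rat.
  rewrite eqf_sqr => /orP[] /eqP xST.
    by exists (y ^+ (n %/ 2) / ratr g2 / t); rewrite rE xST mulfK.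
  by exists (- (y ^+ (n %/ 2) / ratr g2 / t)); rewrite rmorphN /= rE xST mulNr mulfK // opprK.
rewrite (tS _ tf) => /eqP; rewrite -subr_eq0 -{2}[S]mul1r -mulrBl mulf_eq0 (negPf S0) orbF.
by rewrite subr_eq0 (eqr_int _ _ 1).
Qed.

Lemma frob_sign_pm : frob_sign = 1 \/ frob_sign = -1.
Proof.
have jac : jacobi a d0 = 1 \/ jacobi a d0 = -1.
  rewrite /jacobi big_seq; elim/big_rec: _ => [|p x]; first by left.
  rewrite mem_primes => /and3P[pp _ p_d0].
  have p_a : ~~ (p %| a)%N.
    apply/negP => p_a; have : (p %| gcdn a f)%N by rewrite dvdn_gcd p_a (dvdn_trans p_d0) // dvdn_gcdr.
    by rewrite (eqP af) dvdn1 => /eqP p1; rewrite p1 in pp.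
  have leg : legendre a p = 1 \/ legendre a p = -1.
    rewrite /legendre (negPf p_a); case: ifP => _; last by case: ifP; [left|right].
    by rewrite -signr_odd; case: odd; [right|left].
  have pow k : legendre a p ^+ k = 1 \/ legendre a p ^+ k = -1.
    case: leg => ->; first by left; rewrite expr1n.
    by rewrite -signr_odd; case: odd; [right|left].
  by case: (pow (logn p d0)) => ->; case=> ->; rewrite ?mulr1 ?mul1r ?mulrNN; auto.
by rewrite /frob_sign /sign_char; case: jac => ->; do 2?case: ifP => _; rewrite ?mulr1 ?mul1r ?mulrNN; auto.
Qed.

End Level.

(** * Local factors, absolute convergence and the value of the limit *)

Section Assembly.
Variable R : realType.
Hypothesis a_gt0 : (0 < a)%N.
Local Open Scope classical_set_scope.

(* Up to sign, the proportion, among the automorphisms extending sigma_a, of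
   those that are trivial on Q(zeta_p, g^(1/p)). *)
Definition local_term (p : nat) : R :=
  if (p %| f)%N then
    if (p %| a - 1)%N then - (if (p %| h)%N then 1 else p%:R^-1) else 0
  else - (if (p %| h)%N then (p%:R - 1)^-1 else (p%:R * (p%:R - 1))^-1).

Local Notation x := local_term.

Lemma prime_natr_gt1 p : prime p -> 2 <= p%:R :> R.
Proof. by move=> pp; rewrite ler_nat prime_gt1. Qed.

Lemma natr_all (T : Type) (P : pred T) (r : seq T) :
  (all P r)%:R = \prod_(i <- r) (P i)%:R :> R.
Proof.
elim: r => [|i r IHr]; first by rewrite big_nil.
by rewrite big_cons /= -IHr; case: (P i); rewrite ?mul1r ?mul0r.
Qed.

Lemma eq1_mod_gcd n : squarefree n ->
  (a == 1 %[mod gcdn f n])%N = all (fun p => (p %| f)%N ==> (p %| a - 1)%N) (primes n).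
Proof.
move=> sqn; rewrite eqn_mod_dvd //; apply/squarefree_dvdP/allP => [|H p|H p pp].
- exact: squarefree_dvd sqn (dvdn_gcdr _ _).
- rewrite mem_primes => /and3P[pp _ p_n]; apply/implyP => p_f.
  by apply: H; rewrite // dvdn_gcd p_f.
rewrite dvdn_gcd => /andP[p_f p_n].
by have := H p; rewrite mem_primes pp p_n squarefree_gt0 // p_f; apply.
Qed.

Lemma totient_gcd_prod n : squarefree n ->
  totient (gcdn f n) = (\prod_(p <- primes n | p %| f) p.-1)%N.
Proof.
move=> sqn; rewrite squarefree_totient; last exact: squarefree_dvd sqn (dvdn_gcdr _ _).
rewrite -[RHS]big_filter; apply: perm_big.
apply: uniq_perm; rewrite ?filter_uniq ?primes_uniq // => p.
rewrite mem_filter !mem_primes gcdn_gt0 f_gt0 dvdn_gcd squarefree_gt0 //=.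
by case: (prime p); rewrite ?andbF.
Qed.

Lemma sqf_prod_local n : squarefree n ->
  \prod_(p <- primes n) x p =
  (-1) ^+ size (primes n) * (a == 1 %[mod gcdn f n])%N%:R *
  (\prod_(p <- primes n | p %| h) p)%N%:R * (totient (gcdn f n))%:R /
  ((totient n)%:R * n%:R).
Proof.
move=> sqn.
rewrite eq1_mod_gcd // natr_all totient_gcd_prod // (squarefree_totient sqn).
rewrite -[X in _ / (_ * X%:R)](squarefree_prod sqn).
have -> : (-1) ^+ size (primes n) = \prod_(p <- primes n) (-1) :> R.
  by rewrite big_const_seq count_predT iter_mulr_1.
rewrite !natr_prod [X in _ * X * _ / _]big_mkcond [X in _ * X / _]big_mkcond /=.
rewrite -!big_split /= -prodf_div big_seq [RHS]big_seq; apply: eq_bigr => p.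
rewrite mem_primes => /and3P[pp _ _]; have p2 := prime_natr_gt1 pp.
have p_neq0 : p%:R != 0 :> R by rewrite gt_eqF //; lra.
have p1_neq0 : p%:R - 1 != 0 :> R by rewrite gt_eqF //; lra.
have -> : p.-1%:R = p%:R - 1 :> R by rewrite -subn1 natrB ?prime_gt0.
rewrite /local_term; case: (p %| f)%N; case: (p %| a - 1)%N; case: (p %| h)%N => /=;
  by field; rewrite ?p_neq0 ?p1_neq0.
Qed.

Lemma delta_termE n : (0 < n)%N -> delta_term R af g n =
  (totient f)%:R^-1 * (sqf_prod x n +
    frob_sign%:~R *+ disc_cond g1 f * (sqf_prod x n *+ (2 * (`|g1| %/ gcdn `|g1| f) %| n)%N)).
Proof.
move=> n_gt0; rewrite /delta_term /moebius /sqf_prod.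
case: (boolP (squarefree n)) => sqn; last by rewrite !mul0r mul0rn mulr0 addr0 mulr0.
have degE := adj_deg_kummer sqn; rewrite c_aE //.
set D := adj_deg _ in degE *; set H := (\prod_(p <- _ | _) _)%N in degE.
have H_gt0 : (0 < H)%N.
  by rewrite /H big_seq_cond; apply: prodn_cond_gt0 => p /andP[]; rewrite mem_primes => /andP[/prime_gt0].
pose e : nat := if ramified n then 2 else 1.
have tN_gt0 : (0 < totient (lcmn f n))%N by rewrite totient_gt0 lcmn_gt0 f_gt0.
have D_gt0 : (0 < D)%N.
  by rewrite lt0n; apply: contraTneq tN_gt0 => D0; move: degE; rewrite D0 !mul0n => /esym/eqP; rewrite muln_eq0 (gtn_eqF n_gt0) orbF => /eqP ->.
have degR : D%:R * H%:R * e%:R = (totient (lcmn f n))%:R * n%:R :> R.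
  by rewrite -!natrM degE.
have totR : (totient (lcmn f n))%:R * (totient (gcdn f n))%:R = (totient f)%:R * (totient n)%:R :> R.
  by rewrite -!natrM totient_lcm_gcd.
set Pn := \prod_(p <- _) _.
(* The halved degree contributes e = 2 and c_a the condition kappa = 1; for a sign kappa their
   product is 1 + kappa. *)
have -> : Pn + frob_sign%:~R *+ disc_cond g1 f * (Pn *+ (2 * (`|g1| %/ gcdn `|g1| f) %| n)%N) =
    Pn * (e%:R * (ramified n ==> (frob_sign == 1))%:R).
  rewrite /e; have := ramifiedE sqn; case: (boolP (ramified n)) => ram /esym.
    case/andP=> -> ->; rewrite !mulr1n.
    by case: frob_sign_pm => -> /=; rewrite ?mulr1z ?mulrN1z; ring.
  by rewrite mulr1; case: (disc_cond g1 f) => /= [->|_]; rewrite ?mulr0n ?mulr0 ?mul0r addr0 ?mulr1.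
have -> : ((-1) ^+ size (primes n))%:~R = (-1) ^+ size (primes n) :> R.
  by rewrite rmorphXn rmorphN1.
rewrite /Pn sqf_prod_local // -/H -mulnb natrM.
have nz k : (0 < k)%N -> k%:R != 0 :> R by move=> k_gt0; rewrite pnatr_eq0 -lt0n.
have e_gt0 : (0 < e)%N by rewrite /e; case: ifP.
have DE : D%:R = (totient f)%:R * (totient n)%:R * n%:R / (H%:R * e%:R * (totient (gcdn f n))%:R) :> R.
  apply: (canRL (mulfK _)).
    by rewrite !mulf_neq0 ?nz ?totient_gt0 ?gcdn_gt0 ?f_gt0.
  by rewrite !mulrA degR -totR; ring.
rewrite DE; field.
by rewrite ?nz ?totient_gt0 ?gcdn_gt0 ?f_gt0.
Qed.

Lemma sum_primes_below_dvd k N : (0 < k)%N ->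
  \sum_(p <- primes_below N) (p %| k)%N%:R <= (size (primes k))%:R :> R.
Proof.
move=> k_gt0; rewrite -natr_sum ler_nat.
have -> : (\sum_(p <- primes_below N) (p %| k) = size [seq p <- primes_below N | p %| k])%N.
  by rewrite size_filter -sum1_count [RHS]big_mkcond; apply: eq_bigr => p _; case: (_ %| _)%N.
apply: uniq_leq_size; first exact/filter_uniq/primes_below_uniq.
by move=> p; rewrite mem_filter mem_primes_below mem_primes k_gt0 => /andP[-> /andP[->]].
Qed.

(** Telescoping of 1/(p - 1) - 1/p, after bounding the sum over primes by the sum over all
    integers. *)
Lemma sum_primes_below_inv N :
  \sum_(p <- primes_below N) (p%:R * (p%:R - 1))^-1 <= 2 :> R.
Proof.
suff H k : \sum_(0 <= p < k.+2 | prime p) (p%:R * (p%:R - 1))^-1 <= 2 - k.+1%:R^-1 :> R.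
  have inv_ge0 k : 0 <= k.+1%:R^-1 :> R by rewrite invr_ge0.
  rewrite big_filter; case: N => [|[|N]].
  - by rewrite big_geq.
  - by rewrite big_mkcond big_nat1.
  by apply: le_trans (H N) _; rewrite gerBl inv_ge0.
elim: k => [|k IHk].
  by rewrite big_mkcond !big_nat_recr //= big_geq //= invr1; lra.
rewrite big_mkcond big_nat_recr //= -big_mkcond /=.
have k1 : k.+1%:R != 0 :> R by rewrite pnatr_eq0.
have k2 : k.+2%:R != 0 :> R by rewrite pnatr_eq0.
have E : (k.+2%:R * (k.+2%:R - 1))^-1 = k.+1%:R^-1 - k.+2%:R^-1 :> R.
  have -> : k.+2%:R - 1 = k.+1%:R :> R by rewrite -natr1 addrK.
  have -> : k.+2%:R = k.+1%:R + 1 :> R by rewrite natr1.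
  have k1' : k.+1%:R + 1 != 0 :> R by rewrite natr1.
  move: (k.+1%:R) k1 k1' => c c0 c1; by field; rewrite c0 c1.
have : 0 <= k.+1%:R^-1 - k.+2%:R^-1 :> R.
  by rewrite subr_ge0 lef_pV2 ?posrE ?ltr0n // ler_nat.
rewrite E; move: IHk; move: (\sum_(0 <= p < k.+2 | prime p) _) (k.+1%:R^-1) (k.+2%:R^-1) => s c d.
by case: ifP => _; lra.
Qed.

Lemma sum_local_term_le N :
  \sum_(p <- primes_below N) `|x p| <= (size (primes (f * h)))%:R + 2.
Proof.
have fh_gt0 : (0 < f * h)%N by rewrite muln_gt0 f_gt0.
apply: le_trans (lerD (sum_primes_below_dvd N fh_gt0) (sum_primes_below_inv N)).
rewrite -big_split /= big_seq [leRHS]big_seq; apply: ler_sum => p.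
rewrite mem_primes_below => /andP[pp _]; have p2 := prime_natr_gt1 pp.
have p1_gt0 : 0 < p%:R - 1 :> R by lra.
have p_gt0 : 0 < p%:R :> R by lra.
have q_ge0 : 0 <= (p%:R * (p%:R - 1))^-1 :> R by rewrite invr_ge0 mulr_ge0 ?ltW.
have le1 : p%:R^-1 <= 1 :> R by rewrite invf_le1 //; lra.
have le2 : (p%:R - 1)^-1 <= 1 :> R by rewrite invf_le1 //; lra.
have i1 : 0 <= p%:R^-1 :> R by rewrite invr_ge0 ltW.
have i2 : 0 <= (p%:R - 1)^-1 :> R by rewrite invr_ge0 ltW.
rewrite Euclid_dvdM // /local_term.
case: (p %| f)%N; case: (p %| a - 1)%N; case: (p %| h)%N => /=;
  rewrite ?normrN ?normr1 ?normr0 ?ger0_norm //; lra.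
Qed.

Lemma prod_below_dvd k N (F : nat -> R) : (0 < k < N)%N ->
  \prod_(p <- primes_below N | (p %| k)%N) F p = \prod_(p <- primes k) F p.
Proof.
move=> /andP[k_gt0 kN]; rewrite -[LHS]big_filter; apply: perm_big.
apply: uniq_perm => [||p]; [exact/filter_uniq/primes_below_uniq|exact: primes_uniq|].
rewrite mem_filter mem_primes_below mem_primes k_gt0 /=.
have [p_k|_] := boolP (p %| k)%N; last by rewrite andbF.
by rewrite andbT (leq_ltn_trans (dvdn_leq k_gt0 p_k)) ?andbT.
Qed.

(** A prime p dividing a - 1, f and h has local term -1, so its factor vanishes; this is why
    [A_const] is 0 there. Otherwise, for N > f + h, the finite products over (a - 1, f) and h are
    complete and only the tail still varies. *)
Lemma euler_product_cvg :
  (fun N => \prod_(p <- primes_below N) (1 + x p)) @ \oo --> A_const R a f h.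
Proof.
pose k := gcdn (a - 1) f; have k_gt0 : (0 < k)%N by rewrite gcdn_gt0 f_gt0 orbT.
have kE p : (p %| k)%N = (p %| f)%N && (p %| a - 1)%N by rewrite dvdn_gcd andbC.
rewrite /A_const -/k; case: eqP => [co|/eqP nco]; last first.
  have k_h : (1 < gcdn k h)%N by rewrite ltn_neqAle eq_sym nco gcdn_gt0 k_gt0.
  have pp := pdiv_prime k_h; set p := pdiv _ in pp.
  have [p_k p_h] : (p %| k)%N /\ (p %| h)%N by apply/andP; rewrite -dvdn_gcd pdiv_dvd.
  apply: cvg_near_cst; exists p.+1 => // N /= pN.
  rewrite (bigD1_seq p) ?mem_primes_below ?primes_below_uniq ?pp //=.
  move: p_k; rewrite kE => /andP[p_f p_a].
  by rewrite /local_term p_f p_a p_h subrr mul0r.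
apply: cvg_trans (near_eq_cvg _) _; last first.
  by apply: cvgM; [exact: cvg_cst | exact: A_tail_cvg].
exists (f + h).+1 => // N /= fhN.
have kN : (0 < k < N)%N.
  rewrite k_gt0 (leq_ltn_trans _ fhN) //; apply: leq_trans (leq_addr _ _).
  exact: dvdn_leq (dvdn_gcdr _ _).
have hN : (0 < h < N)%N by rewrite h_gt0 (leq_ltn_trans (leq_addl f h)).
rewrite /A_tail -(prod_below_dvd (fun p => 1 - p%:R^-1) kN).
rewrite [X in _ * X * _]big_mkcond -(prod_below_dvd _ hN).
rewrite -big_filter_cond -/(primes_below N).
rewrite [X in X * _ * _]big_mkcond [X in _ * X * _]big_mkcond [X in _ * _ * X]big_mkcond.
rewrite -!big_split /= big_seq [RHS]big_seq; apply: eq_bigr => p.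
rewrite mem_primes_below => /andP[pp _].
have p_kh : (p %| k)%N -> (p %| h)%N = false.
  move=> p_k; apply/negP => p_h; have : (p %| gcdn k h)%N by rewrite dvdn_gcd p_k.
  by rewrite co dvdn1 => /eqP p1; rewrite p1 in pp.
move: p_kh; rewrite kE /local_term.
case: (p %| f)%N; case: (p %| a - 1)%N; case: (p %| h)%N => //= H; rewrite ?mulr1 ?mul1r ?addr0 //.
by have := H isT.
Qed.

Local Notation b := (`|g1| %/ gcdn `|g1| f)%N.
Local Notation beta_factor := (
  (moebius b)%:~R / (\prod_(p <- primes b | (p %| h)%N) (p%:R - 2) *
    \prod_(p <- primes b | ~~ (p %| h)%N) (p%:R ^+ 2 - p%:R - 1)) : R).

Lemma beta_squarefree : squarefree b.
Proof. exact: squarefree_dvd g1_sqf (dvdn_div (dvdn_gcdl _ _)). Qed.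

Lemma double_beta_squarefree : disc_cond g1 f -> squarefree (2 * b).
Proof.
move=> cond; apply: squarefree_mul_prime => //; first exact: beta_squarefree.
by rewrite dvdn2 negbK beta_odd.
Qed.

(** The value is the same in all cases: h is odd, and if f is even then a is odd, so 2 | a - 1. *)
Lemma local_term_2 : x 2 = - 2^-1.
Proof.
have h2 : (2 %| h)%N = false by rewrite dvdn2 index_odd.
rewrite /local_term h2; case: (boolP (2 %| f)%N) => f2.
  suff -> : (2 %| a - 1)%N by [].
  have a_odd : odd a by rewrite -coprimen2; apply: coprime_dvdr f2 af.
  by rewrite dvdn2 oddB // a_odd.
by congr (- _^-1); lra.
Qed.

Lemma beta_prime_gt2 p : disc_cond g1 f -> p \in primes b -> 3 <= p%:R :> R.
Proof.
move=> cond; rewrite mem_primes => /and3P[pp _ p_b]; rewrite ler_nat ltn_neqAle prime_gt1 // andbT.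
by apply: contraTneq p_b => <-; rewrite dvdn2 negbK beta_odd.
Qed.

Lemma local_term_beta p : p \in primes b ->
  x p = - (if (p %| h)%N then (p%:R - 1)^-1 else (p%:R * (p%:R - 1))^-1).
Proof.
by rewrite mem_primes => /and3P[pp _ p_b]; rewrite /local_term (negPf (beta_coprime_f pp p_b)).
Qed.

Lemma local_term_beta_neqN1 p : disc_cond g1 f -> p \in primes b -> 1 + x p != 0.
Proof.
move=> cond p_b; rewrite local_term_beta //; have p3 := beta_prime_gt2 cond p_b.
have i1 : (p%:R - 1)^-1 <= 2^-1 :> R by rewrite lef_pV2 ?posrE; lra.
have i2 : (p%:R * (p%:R - 1))^-1 <= 2^-1 :> R by rewrite lef_pV2 ?posrE; nra.
by rewrite gt_eqF //; case: ifP => _; lra.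
Qed.

Lemma primes_double_beta : disc_cond g1 f -> perm_eq (primes (2 * b)) (2%N :: primes b).
Proof.
move=> cond; have b_gt0 := squarefree_gt0 beta_squarefree.
apply: uniq_perm => [||p]; rewrite ?primes_uniq //=.
  by rewrite primes_uniq mem_primes dvdn2 beta_odd // !andbF.
by rewrite (primesM p (isT : 0 < 2)%N b_gt0) (primes_prime (isT : prime 2)) mem_seq1 in_cons.
Qed.

(** The prime 2 gives the outer minus sign; each p | beta gives -1 over p - 2 or over p^2 - p - 1,
    and these signs multiply to the Moebius value of beta. *)
Lemma twist_factor : disc_cond g1 f ->
  \prod_(p <- primes (2 * b)) (x p / (1 + x p)) = - beta_factor.
Proof.
move=> cond; rewrite (perm_big _ (primes_double_beta cond)) big_cons local_term_2 /=.
have -> : - 2^-1 / (1 - 2^-1) = -1 :> R by field.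
rewrite mulN1r; congr (- _); rewrite /moebius beta_squarefree.
have -> : ((-1) ^+ size (primes b))%:~R = \prod_(p <- primes b) (-1) :> R.
  by rewrite rmorphXn rmorphN1 big_const_seq count_predT iter_mulr_1.
rewrite [X in _ / (X * _)]big_mkcond [X in _ / (_ * X)]big_mkcond -big_split /= -prodf_div.
rewrite big_seq [RHS]big_seq; apply: eq_bigr => p p_b.
have p3 := beta_prime_gt2 cond p_b; have := local_term_beta_neqN1 cond p_b.
rewrite local_term_beta //; case: (p %| h)%N => /= nz; rewrite ?mulr1 ?mul1r; field.
  by rewrite !gt_eqF //; lra.
by apply/and3P; split; rewrite gt_eqF //; [nra|lra|lra].
Qed.

(** Only the finitely many factors at p | 2 beta change, from 1 + x_p to x_p. The former are
    nonzero, so the ratio makes sense even when the whole Euler product is 0. *)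
Lemma twisted_product_cvg : disc_cond g1 f ->
  (fun N => \prod_(p <- primes_below N) ((~~ (p %| 2 * b)%N)%:R + x p)) @ \oo -->
  A_const R a f h * - beta_factor.
Proof.
move=> cond; rewrite -twist_factor //.
apply: cvg_trans (near_eq_cvg _) _; last first.
  by apply: cvgM; [exact: euler_product_cvg | exact: cvg_cst].
have m_gt0 := squarefree_gt0 (double_beta_squarefree cond).
exists (2 * b).+1 => // N /= mN.
rewrite -(@prod_below_dvd (2 * b) N) ?m_gt0 // [X in _ * X]big_mkcond -big_split /=.
rewrite big_seq [RHS]big_seq; apply: eq_bigr => p; rewrite mem_primes_below => /andP[pp _].
case: (boolP (p %| 2 * b)%N) => p_m /=; last by rewrite mulr1.
rewrite add0r mulrC divfK //.
have : p \in primes (2 * b) by rewrite mem_primes pp m_gt0.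
rewrite (perm_mem (primes_double_beta cond)) inE => /orP[/eqP ->|]; last exact: local_term_beta_neqN1.
by rewrite local_term_2 gt_eqF //; lra.
Qed.

Lemma delta_sum_cvg :
  (fun N => \sum_(1 <= n < N) delta_term R af g n) @ \oo -->
  (totient f)%:R^-1 * (A_const R a f h +
    frob_sign%:~R *+ disc_cond g1 f * (A_const R a f h * - beta_factor)).
Proof.
have S1 : (fun N => \sum_(1 <= n < N) sqf_prod x n) @ \oo --> A_const R a f h.
  have -> : (fun N => \sum_(1 <= n < N) sqf_prod x n) =
      (fun N => \sum_(1 <= n < N) sqf_prod x n *+ (1 %| n)%N).
    by apply/funext => N; apply: eq_bigr => n _; rewrite dvd1n.
  apply: sqf_sum_cvg (isT : squarefree 1) sum_local_term_le _.
  rewrite (_ : (fun N => _) = (fun N => \prod_(p <- primes_below N) (1 + x p))).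
    exact: euler_product_cvg.
  apply/funext => N; apply: eq_big_seq => p; rewrite mem_primes_below => /andP[pp _].
  by rewrite dvdn1 gtn_eqF ?prime_gt1.
have E (c : R) : (fun N => \sum_(1 <= n < N) (totient f)%:R^-1 * (sqf_prod x n + c * (sqf_prod x n *+ (2 * b %| n)%N))) =
    (fun N => (totient f)%:R^-1 * (\sum_(1 <= n < N) sqf_prod x n + c * \sum_(1 <= n < N) sqf_prod x n *+ (2 * b %| n)%N)).
  by apply/funext => N; rewrite [in RHS]mulr_sumr -big_split /= mulr_sumr.
rewrite (_ : (fun N => _) = (fun N => \sum_(1 <= n < N) (totient f)%:R^-1 *
    (sqf_prod x n + frob_sign%:~R *+ disc_cond g1 f * (sqf_prod x n *+ (2 * b %| n)%N)))); last first.
  apply/funext => N; rewrite big_nat [RHS]big_nat; apply: eq_bigr => n /andP[n_gt0 _].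
  exact: delta_termE.
rewrite E; apply: cvgM; first exact: cvg_cst.
case: (boolP (disc_cond g1 f)) => cond; last first.
  rewrite mulr0n mul0r addr0.
  by rewrite (_ : (fun N => _) = (fun N => \sum_(1 <= n < N) sqf_prod x n)) //; apply/funext => N; rewrite mul0r addr0.
apply: cvgD => //; apply: cvgM; first exact: cvg_cst.
exact: sqf_sum_cvg (double_beta_squarefree cond) sum_local_term_le (twisted_product_cvg cond).
Qed.

Lemma exprz_N1 (z : int) : (-1) ^ z = (-1) ^+ odd `|z| :> R.
Proof.
case: z => n /=; first by rewrite -exprnP signr_odd.
transitivity (((-1) ^+ n.+1)^-1 : R); first by [].
by rewrite -signr_odd /=; case: (odd n); rewrite ?expr0 ?expr1 ?invrN1 ?invr1.
Qed.

(** If the odd part of g1 is 1 mod 4, the exponent is even. Otherwise the congruence condition makes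
    f even, so a is odd, equals its own odd part, and the parity of (a - 1)/2 decides the sign. *)
Lemma frob_sign_exprz : disc_cond g1 f ->
  frob_sign%:~R = (jacobi a (gcdn `|g1| f))%:~R *
    (-1) ^ (((odd_part g1 - 1) %/ 2)%Z * ((odd_part a%:Z - 1) %/ 2)%Z) :> R.
Proof.
move=> cond; rewrite exprz_N1 abszM oddM /frob_sign intrM mulrC; congr (_ * _).
have [g1E o_odd] := squarefree_odd_part g1_sqf.
move: (odd_part g1) g1E o_odd => o g1E o_odd.
case: ifP => o1.
  by rewrite (_ : odd `|((o - 1) %/ 2)%Z| = false) //; move: o1; clear; lia.
have f2 : (2 %| f)%N.
  by move: cond o1 g1E; rewrite /disc_cond; clear; case: ifP; lia.
have a_odd : odd a by rewrite -coprimen2; apply: coprime_dvdr f2 af.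
have -> : odd_part a%:Z = a%:Z.
  by rewrite /odd_part /= lognE dvdn2 a_odd !andbF expn0 divz1.
have -> : odd `|((o - 1) %/ 2)%Z| by move: o1 o_odd; clear; lia.
rewrite /= /sign_char (_ : odd `|((a%:Z - 1) %/ 2)%Z| = (a %% 4 == 3)%N); last first.
  by move: a_odd a_gt0; clear; lia.
by case: ifP.
Qed.

End Assembly.

End Kummer.

Theorem theorem3 (R : realType) (g : rat)
  (g_neq0 : g != 0) (g_neqN1 : g != -1)
  (g_nonsquare : ~ exists r : rat, g = r ^+ 2)
  (h : nat) (h_gt0 : (0 < h)%N)
  (g_hpower : exists r : rat, g = r ^+ h)
  (h_largest : forall k : nat, (0 < k)%N ->
    (exists r : rat, g = r ^+ k) -> (k <= h)%N)
  (g1 : int) (g2 : rat)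
  (g1_squarefree : squarefree `|g1|%N) (gE : g = g1%:~R * g2 ^+ 2)
  (f a : nat) (f_ge1 : (1 <= f)%N) (a_ge1 : (1 <= a)%N) (a_lef : (a <= f)%N)
  (af : coprime a f) :
  let beta : int := (g1 %/ gcdz g1 f%:Z)%Z in
  cvgn (fun N => \sum_(1 <= n < N) delta_term R af g n) /\
  delta R af g =
    if [|| (g1 == 1 %[mod 4])%Z,
           (g1 == 2 %[mod 4])%Z && (8 %| f)%N
         | (g1 == 3 %[mod 4])%Z && (4 %| f)%N]
    then
      A_const R a f h / (totient f)%:R *
      (1 - (jacobi a `|gcdz g1 f%:Z|%N)%:~R *
           ((-1) ^ (((odd_part g1 - 1) %/ 2)%Z * ((odd_part a%:Z - 1) %/ 2)%Z) *
            (moebius `|beta|%N)%:~R /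
            (\prod_(p <- primes `|beta|%N | (p %| h)%N) (p%:R - 2) *
             \prod_(p <- primes `|beta|%N | ~~ (p %| h)%N) (p%:R ^+ 2 - p%:R - 1))))
    else A_const R a f h / (totient f)%:R.
Proof.
move=> beta.
have lim := delta_sum_cvg (R := R) g_neq0 g_nonsquare h_gt0 g_hpower h_largest g1_squarefree gE f_ge1 af a_ge1.
split; first by apply/cvg_ex; eexists; exact: lim.
rewrite /delta (cvg_lim _ lim) // -/(disc_cond g1 f).
have gcdE : `|gcdz g1 f%:Z|%N = gcdn `|g1| f by [].
have betaE : `|beta|%N = (`|g1| %/ gcdn `|g1| f)%N.
  have d_gt0 : (0 < gcdn `|g1| f)%N by rewrite gcdn_gt0 f_ge1 orbT.
  (* The integer g1 may be negative, but the division is exact, so it commutes with absolute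
     values. *)
  apply/eqP; rewrite -(eqn_pmul2r d_gt0) divnK ?dvdn_gcdl // -{1}gcdE -abszM /beta.
  by rewrite divzK // dvdz_gcdl.
case: ifP => cond; last by rewrite mulr0n mul0r addr0 mulrC.
rewrite mulr1n (frob_sign_exprz g1_squarefree af R a_ge1 cond) gcdE betaE.
by ring.
Qed.
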